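(* Let $\pi\in S_k$. Then the number of $\pi$-hits in each $\tau\in S_n$ can be computed in $\Theta(n!)$ time, where the implied constants do not depend on $k$.
   Context: A permutation in $S_m$ is a word containing each of $1,\dots,m$ exactly once. For $\pi\in S_k$ and $\tau\in S_n$, a $\pi$-hit in $\tau$ is a $k$-letter subsequence of $\tau$ order-isomorphic to $\pi$ (having the same relative order of letters). Model of computation: a word RAM in which each permutation of length at most $n$ (letters stored in fixed-width bit blocks) fits in a constant number of machine words, standard integer and bitwise operations, shifts and popcount take constant time, and hash tables keyed by such words support insertion and lookup in constant time. *)

(* Defs.v *)
From Stdlib Require Import BinNat.
From mathcomp Require Import all_boot all_fingroup.

Set Implicit Arguments.
Unset Strict Implicit.
Unset Printing Implicit Defensive.

(* ['S_n] permutes 0, .., n-1; the word it denotes uses the letters 1, .., n. *)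
Definition perm_word (n : nat) (s : 'S_n) : seq nat :=
  [seq (s i).+1 | i <- enum 'I_n].

Definition order_iso (u v : seq nat) : bool :=
  (size u == size v) &&
  [forall i : 'I_(size u), forall j : 'I_(size u),
     (nth 0 u i < nth 0 u j) == (nth 0 v i < nth 0 v j)].

(* A subsequence of tau is given by its set of positions; [enum A] lists the
   positions in increasing order. *)
Definition hits (k n : nat) (p : 'S_k) (t : 'S_n) : {set {set 'I_n}} :=
  [set A : {set 'I_n} |
     order_iso (perm_word p) [seq (t i).+1 | i <- enum A]].

(* For n > 0 this is the least b such that the letters 1, .., n are < 2 ^ b. *)
Definition letter_bits (n : nat) : nat := (trunc_log 2 n).+1.

(* Letter number i (from 0) occupies the bits b * i, .., b * i + b - 1. *)
Definition pack (b : nat) (s : seq nat) : N :=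
  foldr (fun a x => N.add (N.of_nat a) (N.shiftl x (N.of_nat b))) N0 s.

Definition pack_perm (n : nat) (t : 'S_n) : N :=
  pack (letter_bits n) (perm_word t).

(* Word RAM.  A register, a memory cell, and a key or value of a hash table all
   hold a number below 2 ^ w.  Such a w-bit block stands for a fixed number of
   consecutive machine words, which is why the cost of an operation is left as
   an arbitrary positive constant [cost o] below rather than set to 1. *)

Inductive unop := Onot | Opopcount.

Inductive binop :=
  | Oadd | Osub | Omul | Odiv | Omod
  | Oand | Oor | Oxor | Oshl | Oshr
  | Oeq | Olt.

Fixpoint popcount_pos (x : positive) : N :=
  match x with
  | xH => 1%num
  | xO y => popcount_pos y
  | xI y => N.succ (popcount_pos y)
  end.

Definition popcount (x : N) : N :=
  match x with N0 => N0 | Npos y => popcount_pos y end.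

Definition N_of_bool (b : bool) : N := if b then 1%num else 0%num.

Definition wrap (w : nat) (x : N) : N := N.modulo x (N.pow 2 (N.of_nat w)).

Definition eval_unop (w : nat) (o : unop) (x : N) : N :=
  match o with
  | Onot => wrap w (N.lxor x (N.ones (N.of_nat w)))
  | Opopcount => wrap w (popcount x)
  end.

Definition eval_binop (w : nat) (o : binop) (x y : N) : N :=
  wrap w
    match o with
    | Oadd => N.add x y
    | Osub => N.sub (N.add x (N.pow 2 (N.of_nat w))) y
    | Omul => N.mul x y
    | Odiv => N.div x y
    | Omod => N.modulo x y
    | Oand => N.land x y
    | Oor => N.lor x y
    | Oxor => N.lxor x y
    | Oshl => N.shiftl x y
    | Oshr => N.shiftr x y
    | Oeq => N_of_bool (N.eqb x y)
    | Olt => N_of_bool (N.ltb x y)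
    end.

(* Registers are named by naturals, so that a program uses finitely many. *)
Inductive instr :=
  | Const (d : nat) (c : N)         (* d := c *)
  | Move (d x : nat)                (* d := x *)
  | Un (o : unop) (d x : nat)       (* d := o x *)
  | Bin (o : binop) (d x y : nat)   (* d := x o y *)
  | Fetch (d a : nat)                (* d := mem[a] *)
  | Store (a x : nat)               (* mem[a] := x *)
  | Insert (t key x : nat)          (* table[t][key] := x *)
  | Lookup (d f t key : nat).       (* d := table[t][key], f := 1 if the key is
                                       present, else d := 0, f := 0 *)

Inductive cmd :=
  | Skip
  | Do (i : instr)
  | Seq (c1 c2 : cmd)
  | If (x : nat) (c1 c2 : cmd)
  | While (x : nat) (c : cmd).

Inductive opcode :=
  | KConst | KMove | KUn (o : unop) | KBin (o : binop)
  | KFetch | KStore | KInsert | KLookup | KTest.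

Definition opcode_of (i : instr) : opcode :=
  match i with
  | Const _ _ => KConst
  | Move _ _ => KMove
  | Un o _ _ => KUn o
  | Bin o _ _ _ => KBin o
  | Fetch _ _ => KFetch
  | Store _ _ => KStore
  | Insert _ _ _ => KInsert
  | Lookup _ _ _ _ => KLookup
  end.

Record state := State {
  reg : nat -> N;
  mem : N -> N;
  table : N -> N -> option N }.

Definition set_reg (s : state) (d : nat) (v : N) : state :=
  State (fun r => if r == d then v else reg s r) (mem s) (table s).

Definition set_mem (s : state) (a v : N) : state :=
  State (reg s) (fun b => if N.eqb b a then v else mem s b) (table s).

Definition set_table (s : state) (t key v : N) : state :=
  State (reg s) (mem s)
    (fun t' key' =>
       if N.eqb t' t && N.eqb key' key then Some v else table s t' key').

Definition step (w : nat) (i : instr) (s : state) : state :=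
  match i with
  | Const d c => set_reg s d (wrap w c)
  | Move d x => set_reg s d (reg s x)
  | Un o d x => set_reg s d (eval_unop w o (reg s x))
  | Bin o d x y => set_reg s d (eval_binop w o (reg s x) (reg s y))
  | Fetch d a => set_reg s d (mem s (reg s a))
  | Store a x => set_mem s (reg s a) (reg s x)
  | Insert t key x => set_table s (reg s t) (reg s key) (reg s x)
  | Lookup d f t key =>
      match table s (reg s t) (reg s key) with
      | Some v => set_reg (set_reg s d v) f 1%num
      | None => set_reg (set_reg s d N0) f N0
      end
  end.

(* [exec w cost c s T s']: started in s, the command c halts in s' after time T. *)
Inductive exec (w : nat) (cost : opcode -> nat) :
    cmd -> state -> nat -> state -> Prop :=
  | exec_skip s : exec w cost Skip s 0 s
  | exec_do i s : exec w cost (Do i) s (cost (opcode_of i)) (step w i s)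
  | exec_seq c1 c2 s1 s2 s3 T1 T2 :
      exec w cost c1 s1 T1 s2 -> exec w cost c2 s2 T2 s3 ->
      exec w cost (Seq c1 c2) s1 (T1 + T2) s3
  | exec_if_true x c1 c2 s T s' :
      reg s x <> N0 -> exec w cost c1 s T s' ->
      exec w cost (If x c1 c2) s (cost KTest + T) s'
  | exec_if_false x c1 c2 s T s' :
      reg s x = N0 -> exec w cost c2 s T s' ->
      exec w cost (If x c1 c2) s (cost KTest + T) s'
  | exec_while_true x c s1 s2 s3 T1 T2 :
      reg s1 x <> N0 -> exec w cost c s1 T1 s2 ->
      exec w cost (While x c) s2 T2 s3 ->
      exec w cost (While x c) s1 (cost KTest + T1 + T2) s3
  | exec_while_false x c s :
      reg s x = N0 -> exec w cost (While x c) s (cost KTest) s.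

(* Input: n in register 0, k in register 1, and the k letters of the pattern in
   the memory cells 0, .., k-1; everything else is zero or empty. *)
Definition init_state (n k : nat) (p : 'S_k) : state :=
  State
    (fun r => match r with 0 => N.of_nat n | 1 => N.of_nat k | _ => N0 end)
    (fun a => nth N0 [seq N.of_nat x | x <- perm_word p] (N.to_nat a))
    (fun _ _ => None).

(* Output: table 0 maps each packed permutation of length n to its hit count. *)
Definition outputs_hits (n k : nat) (p : 'S_k) (s : state) : Prop :=
  forall t : 'S_n,
    table s N0 (pack_perm t) = Some (N.of_nat #|hits p t|).

(* Main.v *)
(** Replace the top [i] letters of the pattern by zeros, and let [f i x] be the
    number of matches of that marked pattern in a word [x] made of [i] zeros and
    the letters 1, .., m, where zeros match zeros only.  A match has to use every
    zero of [x].  If [x] arises from [y] by inserting its largest letter [m] at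
    position [l], the matches avoiding [m] are those of [y], while the matches
    using [m] send it to the letter [k - i] of the pattern; they exist only if the
    numbers of zeros in front of the two agree, and then turning both into zeros
    gives
      [f i x = f i y + (zeros before l = zeros before k - i) * f i.+1 (y with 0 at l)].
    The program tabulates [f i] for [i] going down to 0, on all words of length at
    most [n], generated by repeated insertion of the next letter.  Each entry costs
    constant time, and there are at most
      [\sum_i \sum_(N <= n) N! / i! = O(n!)]
    of them.  Conversely [n!] distinct keys must be inserted into the output table. *)

Require Import Defs.
From Stdlib Require Import BinNat.
From mathcomp Require Import all_boot all_fingroup.
From mathcomp Require Import zify.

Set Implicit Arguments.
Unset Strict Implicit.
Unset Printing Implicit Defensive.

(** * Counting marked matches *)

(** Entries are listed with multiplicity, one for each set of positions, so counting in this list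
    counts occurrences. *)
Fixpoint subs (x : seq nat) : seq (seq nat) :=
  if x is a :: y then map (cons a) (subs y) ++ subs y else [:: [::]].

Lemma count_subs_cons P a y :
  count P (subs (a :: y)) = count (fun u => P (a :: u)) (subs y) + count P (subs y).
Proof. by rewrite /= count_cat count_map. Qed.

Lemma mem_subs_subseq x u : u \in subs x -> subseq u x.
Proof.
elim: x u => [|a x IH] u /=; first by rewrite inE.
rewrite mem_cat => /orP[/mapP[v /IH uv ->]|/IH ux]; first by rewrite /= eqxx.
exact: subseq_trans ux (subseq_cons _ _).
Qed.

Lemma size_subs x : size (subs x) = 2 ^ size x.
Proof. by elim: x => //= a x IH; rewrite size_cat size_map IH expnS mul2n addnn. Qed.

Lemma count_subs_full x : count (fun u => size u == size x) (subs x) = 1.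
Proof.
elim: x => // a x IH; rewrite count_subs_cons /=.
under eq_count do rewrite eqSS.
rewrite IH; congr _.+1; apply/eqP; rewrite -leqn0 leqNgt -has_count.
apply/hasPn => u /mem_subs_subseq/size_subseq sz; by rewrite neq_ltn ltnS sz.
Qed.

Definition ins l (c : nat) (y : seq nat) := take l y ++ c :: drop l y.

(** A subsequence either skips the displayed [c] or splits around it into subsequences of [y1] and
    [y2]. *)
Lemma count_subs_ins P y1 c y2 :
  count P (subs (y1 ++ c :: y2)) = count P (subs (y1 ++ y2)) +
    \sum_(u1 <- subs y1) count (fun u2 => P (u1 ++ c :: u2)) (subs y2).
Proof.
elim: y1 P => [|a y1 IH] P.
  by rewrite cat0s /= big_seq1 count_cat count_map addnC.
rewrite !cat_cons !count_subs_cons !IH /= big_cat big_map /=; lia.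
Qed.

(* The extra pair [(0, 0)] makes zeros match zeros only. *)
Definition oi0 (p u : seq nat) : bool :=
  (size p == size u) &&
  allrel (fun c d : nat * nat => (c.1 < d.1) == (c.2 < d.2))
    ((0, 0) :: zip p u) ((0, 0) :: zip p u).

Lemma oi0P p u :
  reflect (size p = size u /\
    forall c d, c \in (0, 0) :: zip p u -> d \in (0, 0) :: zip p u ->
      (c.1 < d.1) = (c.2 < d.2))
    (oi0 p u).
Proof.
apply: (iffP andP) => [[/eqP sz /allrelP H]|[sz H]]; split=> //.
- by move=> c d hc hd; exact: (eqP (H c d hc hd)).
- exact/eqP.
by apply/allrelP => c d hc hd; apply/eqP; exact: H.
Qed.

Lemma oi0_size p u : oi0 p u -> size p = size u.
Proof. by case/oi0P. Qed.

Lemma oi0_nth p u i j : oi0 p u -> i < size p -> j < size p ->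
  (nth 0 p i < nth 0 p j) = (nth 0 u i < nth 0 u j).
Proof.
case/oi0P=> sz H hi hj.
have E a : a < size p -> (nth 0 p a, nth 0 u a) \in (0, 0) :: zip p u.
  move=> ha; rewrite inE -nth_zip //; apply/orP; right.
  by apply: mem_nth; rewrite size_zip -sz minnn.
exact: (H _ _ (E _ hi) (E _ hj)).
Qed.

Lemma oi0_zeros p u : oi0 p u -> map (eq_op 0) p = map (eq_op 0) u.
Proof.
case/oi0P=> sz H; apply: (@eq_from_nth _ true); rewrite !size_map // => i hi.
rewrite !(nth_map 0) -?sz //.
have: (nth 0 p i, nth 0 u i) \in (0, 0) :: zip p u.
  rewrite inE -nth_zip //; apply/orP; right.
  by apply: mem_nth; rewrite size_zip -sz minnn.
by move/(H (0, 0) _ (mem_head _ _)) => /=; case: (nth 0 p i) (nth 0 u i) => [|?] [|?].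
Qed.

(** The new pair is [(0, 0)], which the list of compared pairs already contains. *)
Lemma oi0_zero p1 p2 u1 u2 : size p1 = size u1 ->
  oi0 (p1 ++ 0 :: p2) (u1 ++ 0 :: u2) = oi0 (p1 ++ p2) (u1 ++ u2).
Proof.
move=> sz; rewrite /oi0 !size_cat /= sz !zip_cat //= !addnS eqSS; congr andb.
apply: eq_allrel_mem2 => c; rewrite !(inE, mem_cat); do ?case: eqP => //=.
Qed.

Lemma mem_zip (s t : seq nat) a b : (a, b) \in zip s t -> a \in s /\ b \in t.
Proof.
elim: s t => [|x s IH] [|y t] //=; rewrite !inE => /orP[|/IH[-> ->]].
  by rewrite xpair_eqE => /andP[-> ->].
by rewrite !orbT.
Qed.

(** The new pair [(t, m)] strictly exceeds all others in both coordinates, so its comparisons agree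
    automatically. *)
Lemma oi0_max p1 p2 u1 u2 t m : size p1 = size u1 ->
  all (fun a => a < t) (0 :: p1 ++ p2) -> all (fun a => a < m) (0 :: u1 ++ u2) ->
  oi0 (p1 ++ t :: p2) (u1 ++ m :: u2) = oi0 (p1 ++ p2) (u1 ++ u2).
Proof.
move=> sz ht hm.
have lt_max c : c \in (0, 0) :: zip (p1 ++ p2) (u1 ++ u2) -> c.1 < t /\ c.2 < m.
  rewrite inE => /predU1P[->|]; first by move: ht hm => /= /andP[-> _] /andP[-> _].
  case: c => c1 c2 /mem_zip[h1 h2].
  by split; [apply: (allP ht)|apply: (allP hm)]; rewrite inE ?h1 ?h2 orbT.
have E c : (c \in (0, 0) :: zip (p1 ++ t :: p2) (u1 ++ m :: u2)) =
           (c == (t, m)) || (c \in (0, 0) :: zip (p1 ++ p2) (u1 ++ u2)).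
  by rewrite !zip_cat //= !(inE, mem_cat); case: (c == (t, m)); rewrite /= ?orbT ?orbF.
apply/oi0P/oi0P; rewrite !size_cat /= => -[sz' H]; split.
- by lia.
- by move=> c d hc hd; apply: H; rewrite E ?hc ?hd orbT.
- by lia.
move=> c d; rewrite !E => /predU1P[->|hc] /predU1P[->|hd] /=.
- by rewrite !ltnn.
- by have [h1 h2] := lt_max _ hd; rewrite !ltnNge (ltnW h1) (ltnW h2).
- by have [-> ->] := lt_max _ hc.
exact: H.
Qed.

Lemma nth_lt_max p1 p2 t i : all (fun a => a < t) (p1 ++ p2) ->
  i < size (p1 ++ t :: p2) -> i != size p1 -> nth 0 (p1 ++ t :: p2) i < t.
Proof.
rewrite size_cat nth_cat /= => ht hs ne; case: (ltnP i) => hi.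
  by apply: (allP ht (nth 0 p1 i)); rewrite mem_cat mem_nth.
case E: (i - size p1) => [|j] /=; first by lia.
have hj : j < size p2 by lia.
by apply: (allP ht (nth 0 p2 j)); rewrite mem_cat (mem_nth 0 hj) orbT.
Qed.

(** If the maxima stood at different positions, comparing these two positions would give opposite
    strict inequalities in the two words. *)
Lemma oi0_max_size p1 p2 u1 u2 t m :
  all (fun a => a < t) (p1 ++ p2) -> all (fun a => a < m) (u1 ++ u2) ->
  oi0 (p1 ++ t :: p2) (u1 ++ m :: u2) -> size p1 = size u1.
Proof.
move=> ht hm oi; have sz := oi0_size oi.
have nth_mid (q1 q2 : seq nat) c : nth 0 (q1 ++ c :: q2) (size q1) = c.
  by rewrite nth_cat ltnn subnn.
have size_lt (q1 q2 : seq nat) c : size q1 < size (q1 ++ c :: q2).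
  by rewrite size_cat /= addnS ltnS leq_addr.
apply/eqP/negPn/negP => ne.
have h1 : size u1 < size (p1 ++ t :: p2) by rewrite sz size_lt.
have h2 : size p1 < size (u1 ++ m :: u2) by rewrite -sz size_lt.
have := oi0_nth oi h1 (size_lt _ _ _); rewrite !nth_mid.
rewrite (nth_lt_max ht h1) 1?eq_sym // => /esym /ltnW.
by rewrite leqNgt (nth_lt_max hm h2).
Qed.

Lemma same_rank_size (b1 b2 c1 c2 : seq bool) :
  b1 ++ true :: b2 = c1 ++ true :: c2 -> count id b1 = count id c1 ->
  size b1 = size c1.
Proof.
elim: b1 c1 => [|b b1 IH] [|c c1] //=.
- by case=> <- _.
- by case=> -> _.
by case=> -> E; rewrite !addnE => /addnI/IH -> .
Qed.

(** * Marked patterns and the recurrence for their matches *)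

Definition zeros (x : seq nat) : nat := count (eq_op 0) x.

Lemma zeros_cat x y : zeros (x ++ y) = zeros x + zeros y.
Proof. exact: count_cat. Qed.

Lemma zeros_subseq x y : subseq x y -> zeros x <= zeros y.
Proof. exact: leq_count_subseq. Qed.

Lemma oi0_count_zeros p u : oi0 p u -> zeros p = zeros u.
Proof. by move/oi0_zeros/(congr1 (count id)); rewrite !count_map. Qed.

Definition pat k i (P : seq nat) := [seq if a <= k - i then a else 0 | a <- P].

Definition matches k P i x := count (oi0 (pat k i P)) (subs x).

(** For [i < k] the letter [k - i] is the largest one left unmarked; this is the number of zeros in
    front of it in the marked pattern. *)
Definition rank_above k P i :=
  count (fun a => k - i < a) (take (index (k - i) P) P).

Lemma zeros_pat k P i : 0 \notin P -> zeros (pat k i P) = count (fun a => k - i < a) P.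
Proof.
move=> P0; rewrite /zeros count_map; apply: eq_in_count => a aP /=.
have /negPf a0 : 0 != a by apply: contraNneq P0 => ->.
by case: leqP => //; rewrite a0.
Qed.

Section Recurrence.

Variables (k : nat) (P : seq nat).
Hypothesis PE : perm_eq P (iota 1 k).

Lemma notin0_word : 0 \notin P.
Proof. by rewrite (perm_mem PE) mem_iota. Qed.

Lemma size_word : size P = k.
Proof. by rewrite (perm_size PE) size_iota. Qed.

Lemma zeros_pat_word i : i <= k -> zeros (pat k i P) = i.
Proof.
move=> ik; rewrite zeros_pat ?notin0_word // (seq.permP PE).
have -> : k = (k - i) + i by rewrite subnK.
rewrite iotaD count_cat.
rewrite (eq_in_count (a2 := pred0)) ?count_pred0; last first.
  by move=> a; rewrite mem_iota addnK /=; lia.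
rewrite (eq_in_count (a2 := predT)) ?count_predT ?size_iota //.
by move=> a; rewrite mem_iota addnK /=; lia.
Qed.

(** Going from [i] to [i.+1] marks exactly one more letter, namely the current maximum [k - i]. *)
Lemma pat_split i : i < k -> exists q1 q2,
  [/\ pat k i P = q1 ++ k - i :: q2, pat k i.+1 P = q1 ++ 0 :: q2,
      all (fun a => a < k - i) (0 :: q1 ++ q2) & zeros q1 = rank_above k P i].
Proof.
move=> ik; set t := k - i.
have tP : t \in P by rewrite (perm_mem PE) mem_iota /t; lia.
have uP : uniq P by rewrite (perm_uniq PE) iota_uniq.
have EP : P = take (index t P) P ++ t :: drop (index t P).+1 P.
  by rewrite -{2}(nth_index 0 tP) -drop_nth ?index_mem // cat_take_drop.
have t0 : 0 < t by rewrite /t; lia.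
pose g a := if a <= k - i.+1 then a else 0.
have gE a : a != t -> (if a <= t then a else 0) = g a.
  by move=> at_; rewrite /g; congr (if _ then _ else _); move: at_; rewrite /t; lia.
exists (map g (take (index t P) P)), (map g (drop (index t P).+1 P)).
move: uP; rewrite {1}EP cat_uniq /= negb_or -!andbA => /and5P[_ t1 _ t2 _].
have E1 : {in take (index t P) P, forall a, a != t}.
  by move=> a; apply: contraTneq => ->.
have E2 : {in drop (index t P).+1 P, forall a, a != t}.
  by move=> a; apply: contraTneq => ->.
split.
- rewrite /pat {1}EP map_cat /= -/t leqnn; congr (_ ++ _ :: _).
    by apply/eq_in_map => a /E1/gE.
  by apply/eq_in_map => a /E2/gE.
- rewrite /pat {1}EP map_cat /= -/(g t); congr (_ ++ _ :: _).
  by rewrite /g /t; case: ifP => //; lia.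
- rewrite /= t0 -map_cat all_map; apply/allP => a _ /=.
  by rewrite /g; case: ifP => //; rewrite /t; lia.
rewrite /zeros count_map; apply: eq_in_count => a ha /=.
have aP : a != 0.
  by apply: contraNneq notin0_word => <-; apply: mem_take ha.
have := E1 _ ha; rewrite /g -/t; case: ifP; rewrite /t; lia.
Qed.

Lemma matches_few_zeros i x : i <= k -> zeros x < i -> matches k P i x = 0.
Proof.
move=> ik zx; apply/eqP; rewrite -leqn0 leqNgt -has_count; apply/hasPn => u /mem_subs_subseq su.
apply: contraTN zx => /oi0_count_zeros; rewrite zeros_pat_word // -leqNgt => ->.
exact: zeros_subseq.
Qed.

(* Both matches use all the zeros of [y1 ++ y2], so the number of zeros of [y1]
   tells the position of the marked letter in the pattern. *)
Lemma oi0_pat_ins i m y1 y2 u1 u2 : i < k -> all (fun a => a < m) (0 :: y1 ++ y2) ->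
  zeros (y1 ++ y2) = i -> subseq u1 y1 -> subseq u2 y2 ->
  oi0 (pat k i P) (u1 ++ m :: u2) =
  (zeros y1 == rank_above k P i) && oi0 (pat k i.+1 P) (u1 ++ 0 :: u2).
Proof.
move=> ik hm; rewrite zeros_cat => zy s1 s2.
have [q1 [q2 [E1 E2 hq zq]]] := pat_split ik.
have hu : all (fun a => a < m) (0 :: u1 ++ u2).
  move: hm => /= /andP[-> /allP hm]; apply/allP => a.
  rewrite mem_cat => /orP[/(mem_subseq s1)|/(mem_subseq s2)] ha; apply: hm;
    by rewrite mem_cat ha ?orbT.
have zi : zeros q1 + zeros q2 = i.
  have := zeros_pat_word (ltnW ik); rewrite E1 zeros_cat /zeros /=.
  by case/andP: hq; case: (k - i).
have z1 := zeros_subseq s1; have z2 := zeros_subseq s2.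
have rank : oi0 (q1 ++ 0 :: q2) (u1 ++ 0 :: u2) -> zeros y1 = zeros u1.
  by move/oi0_count_zeros; rewrite !zeros_cat {2 4}/zeros /= -!/(zeros _); lia.
rewrite E1 E2 -zq; apply/idP/andP => [oi|[/eqP zl oi]].
  have sz : size q1 = size u1.
    by apply: oi0_max_size oi; [case/andP: hq|case/andP: hu].
  have oi' : oi0 (q1 ++ 0 :: q2) (u1 ++ 0 :: u2).
    by rewrite oi0_zero // -(oi0_max sz hq hu).
  split=> //; rewrite (rank oi'); have /eqP := oi0_zeros oi'.
  rewrite !map_cat eqseq_cat ?size_map // => /andP[/eqP E _].
  by have := congr1 (count id) E; rewrite !count_map /zeros => ->.
have sz : size q1 = size u1.
  have := oi0_zeros oi; rewrite !map_cat /= => /same_rank_size.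
  rewrite !size_map !count_map; apply; exact: etrans (esym zl) (rank oi).
by rewrite (oi0_max sz hq hu) -(oi0_zero q2 u2 sz).
Qed.

Lemma matches_ins i l m y : i < k -> all (fun a => a < m) (0 :: y) -> zeros y = i ->
  matches k P i (ins l m y) =
  matches k P i y + (zeros (take l y) == rank_above k P i) * matches k P i.+1 (ins l 0 y).
Proof.
move=> ik hm zy; rewrite /matches /ins !count_subs_ins cat_take_drop.
(* On the right, the subsequences of [ins l 0 y] that skip the new zero contribute nothing: [y] has
   only [i] zeros and the pattern has [i.+1]. *)
have := matches_few_zeros (x := y) ik; rewrite zy ltnSn /matches => -> //; rewrite add0n.
congr (_ + _); rewrite big_distrr /=; apply: eq_big_seq => u1 /mem_subs_subseq s1.
transitivity (count (fun u2 => (zeros (take l y) == rank_above k P i) &&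
    oi0 (pat k i.+1 P) (u1 ++ 0 :: u2)) (subs (drop l y))); last first.
  by case: eqP => _; rewrite ?mul1n // mul0n -[RHS](count_pred0 (subs (drop l y))).
apply: eq_in_count => u2 /mem_subs_subseq s2.
by apply: oi0_pat_ins s1 s2; rewrite ?cat_take_drop.
Qed.

(** For [k <= i] every letter of the pattern is marked, so no match can use the positive letter
    [m]. *)
Lemma matches_ins_full i l m y : k <= i -> 0 < m -> matches k P i (ins l m y) = matches k P i y.
Proof.
move=> ki m0; rewrite /matches /ins count_subs_ins cat_take_drop big1_seq ?addn0 // => u1 _.
rewrite -[RHS](count_pred0 (subs (drop l y))); apply: eq_count => u2 /=.
apply/negP => /oi0_zeros E; have : true = false; last by [].
have -> : true = all id (map (eq_op 0) (pat k i P)).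
  rewrite all_map all_map; apply/esym/allP => a /=; rewrite (perm_mem PE) mem_iota => ha.
  by have -> : (a <= k - i) = false by lia.
by rewrite E map_cat all_cat /= -(prednK m0) /= andbF.
Qed.

(** Initial value of the recurrence: a match has length [k], so the word is too short unless
    [i = k], when only the full word matches. *)
Lemma matches_nseq i : i <= k -> matches k P i (nseq i 0) = (i == k).
Proof.
move=> ik; case: eqP => [->|/eqP ne].
  rewrite -[RHS](count_subs_full (nseq k 0)) /matches; apply: eq_in_count => u.
  move/mem_subs_subseq => su; rewrite size_nseq.
  apply/idP/eqP => [/oi0_size|szu]; first by rewrite size_map size_word.
  apply/oi0P; rewrite size_map size_word szu; split=> // c d.
  suff Z c' : c' \in (0, 0) :: zip (pat k k P) u -> c' = (0, 0) by move=> /Z-> /Z->.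
  rewrite inE => /predU1P[//|]; case: c' => a b /mem_zip[/mapP[e]].
  rewrite (perm_mem PE) mem_iota => he -> /(mem_subseq su); rewrite mem_nseq => /andP[_ /eqP ->].
  by have -> : (e <= k - k) = false by lia.
apply/eqP; rewrite -leqn0 leqNgt -has_count; apply/hasPn => u /mem_subs_subseq su.
apply: contraNN ne => /oi0_size; rewrite size_map size_word => E.
by rewrite eqn_leq ik E -[X in _ <= X](size_nseq i 0) size_subseq.
Qed.

Lemma matches_short i x : size x < k -> matches k P i x = 0.
Proof.
move=> xk; apply/eqP; rewrite -leqn0 leqNgt -has_count; apply/hasPn => u /mem_subs_subseq su.
apply: contraTN xk => /oi0_size; rewrite size_map size_word -leqNgt => ->.
exact: size_subseq.
Qed.

End Recurrence.

Lemma matches_le_exp k P i x : matches k P i x <= 2 ^ size x.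
Proof. by rewrite -size_subs count_size. Qed.

(** * Sets of positions as masks, and hits as matches *)

Fixpoint masks n : seq bitseq :=
  if n is m.+1 then map (cons true) (masks m) ++ map (cons false) (masks m)
  else [:: [::]].

Lemma subs_masks x : subs x = [seq mask m x | m <- masks (size x)].
Proof. by elim: x => //= a x IH; rewrite map_cat -!map_comp IH -map_comp. Qed.

Lemma mem_masks n m : (m \in masks n) = (size m == n).
Proof.
elim: n m => [|n IH] [|b m] //=; rewrite mem_cat.
  by apply/negP => /orP[] /mapP[].
rewrite eqSS -IH; apply/orP/idP => [[] /mapP[m' hm [_ ->]] //|hm].
by case: b; [left|right]; apply: map_f.
Qed.

Lemma masks_uniq n : uniq (masks n).
Proof.
elim: n => //= n IH; rewrite cat_uniq !map_inj_uniq ?IH => [|a b []|a b []] //=.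
by rewrite andbT; apply/hasPn => _ /mapP[m _ ->]; apply/mapP => -[].
Qed.

Lemma perm_word_iota n (t : 'S_n) : perm_eq (perm_word t) (iota 1 n).
Proof.
apply: uniq_perm; rewrite ?iota_uniq //.
  by rewrite map_inj_uniq ?enum_uniq // => i j [] /val_inj/perm_inj.
move=> a; rewrite mem_iota; apply/mapP/idP => [[i _ ->]|/andP[a0 an]].
  by rewrite /= add1n ltnS ltn_ord.
have an' : a.-1 < n by lia.
exists (t^-1 (Ordinal an'))%g; first by rewrite mem_enum.
by rewrite permKV prednK.
Qed.

(** For positive letters the extra pair [(0, 0)] lies below every other pair in both coordinates and
    adds no constraint. *)
Lemma order_iso_oi0 u v : 0 \notin u -> 0 \notin v -> order_iso u v = oi0 u v.
Proof.
move=> u0 v0; apply/andP/oi0P => [[/eqP sz H]|[sz H]].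
  split=> //.
  have pos c : c \in zip u v -> 0 < c.1 /\ 0 < c.2.
    case: c => a b /mem_zip[ha hb]; rewrite !lt0n.
    by split; [apply: contraNneq u0 => <-|apply: contraNneq v0 => <-].
  move=> c d; rewrite !inE => /predU1P[->|hc] /predU1P[->|hd] //=.
  - by have [-> ->] := pos _ hd.
  - have [i hi <-] := nthP (0, 0) hc; have [j hj <-] := nthP (0, 0) hd.
    rewrite !nth_zip //=; rewrite size_zip -sz minnn in hi hj.
    by move/forallP/(_ (Ordinal hi))/forallP/(_ (Ordinal hj))/eqP: H.
split; first exact/eqP.
apply/forallP => i; apply/forallP => j; apply/eqP.
have oi : oi0 u v by apply/oi0P.
exact: oi0_nth.
Qed.

Lemma card_hits k n (p : 'S_k) (t : 'S_n) :
  #|hits p t| = matches k (perm_word p) 0 (perm_word t).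
Proof.
have P0 m (s : 'S_m) : 0 \notin perm_word s.
  by rewrite (perm_mem (perm_word_iota s)) mem_iota.
have -> : matches k (perm_word p) 0 (perm_word t) =
    count (fun m => order_iso (perm_word p) (mask m (perm_word t))) (masks n).
  rewrite /matches subs_masks /perm_word size_map size_enum_ord count_map.
  apply: eq_count => m /=; rewrite -!/(perm_word _).
  have -> : pat k 0 (perm_word p) = perm_word p.
    rewrite -[RHS]map_id; apply/eq_in_map => a.
    by rewrite (perm_mem (perm_word_iota p)) mem_iota subn0 => /andP[_ ha]; rewrite -ltnS ha.
  rewrite order_iso_oi0 //; apply: contra (P0 _ t) => /mem_mask; exact.
(* The indicator mask of a set of positions; this injection carries the hits onto the masks that
   select a match. *)
pose g (A : {set 'I_n}) := [seq i \in A | i <- enum 'I_n].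
have gE A : mask (g A) (perm_word t) = [seq (t i).+1 | i <- enum A].
  rewrite /perm_word -map_mask -filter_mask; congr map.
  by rewrite {2}/enum_mem enumT.
have g_inj : injective g.
  move=> A B /eq_in_map E; apply/setP => i; apply: E; exact: mem_enum.
rewrite -size_filter cardE -(size_map g); apply: perm_size.
apply: uniq_perm.
- by rewrite map_inj_uniq // enum_uniq.
- by rewrite filter_uniq // masks_uniq.
move=> m; rewrite mem_filter mem_masks; apply/mapP/andP => [[A]|[oi /eqP sz]].
  rewrite mem_enum inE => oi ->; rewrite gE; split=> //.
  by rewrite size_map size_enum_ord.
have mE : m = g [set i : 'I_n | nth false m i].
  apply: (@eq_from_nth _ false); first by rewrite size_map size_enum_ord.
  move=> i; rewrite sz => hi.
  by rewrite (nth_map (Ordinal hi)) ?size_enum_ord // inE nth_enum_ord.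
exists [set i : 'I_n | nth false m i] => //.
by rewrite mem_enum inE -gE -mE.
Qed.

(** * Packed words and their enumeration *)

(** [pack] on natural numbers, for an arbitrary base; the first letter is the least significant
    digit. *)
Definition pk B (x : seq nat) := foldr (fun a r => a + r * B) 0 x.

Lemma pk_cat B x y : pk B (x ++ y) = pk B x + B ^ size x * pk B y.
Proof.
elim: x => [|a x IH] /=; first by rewrite mul1n.
by rewrite IH expnS mulnDl addnA mulnAC (mulnC B).
Qed.

Lemma pk_lt B x : all (fun a => a < B) x -> pk B x < B ^ size x.
Proof.
elim: x => //= a x IH /andP[aB /IH px]; rewrite expnS.
by have := leq_mul (leqnn B) px; rewrite mulnS (mulnC B (pk B x)); lia.
Qed.

(* Words with equal packings differ only by trailing zeros. *)
Lemma pk_inj B x y : all (fun a => a < B) x -> all (fun a => a < B) y ->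
  zeros x = zeros y -> pk B x = pk B y -> x = y.
Proof.
have pk0 z : 0 < B -> pk B z = 0 -> zeros z = size z.
  rewrite /zeros => B0; elim: z => //= a z IH /eqP; rewrite addn_eq0 muln_eq0.
  by case/andP => /eqP -> /orP[/eqP/IH -> //|]; lia.
elim: x y => [|a x IH] [|b y] //.
- move=> _ /andP[bB _] E /esym/(pk0 (b :: y)); rewrite -E => H.
  by have := H (leq_ltn_trans (leq0n _) bB).
- move=> /andP[aB _] _ E /(pk0 (a :: x)); rewrite E => H.
  by have := H (leq_ltn_trans (leq0n _) aB).
move=> /andP[aB hx] /andP[bB hy] E.
have B0 : 0 < B by lia.
move=> /[dup] /(congr1 (modn^~ B)) + /(congr1 (divn^~ B)).
rewrite /= ![_ + _ * B]addnC !modnMDl !divnMDl // !modn_small // !divn_small // !addn0.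
move=> ab; rewrite ab in E *; move=> /IH -> //.
by move: E; rewrite /zeros /= => /addnI.
Qed.

Lemma of_nat_pow2 w : N.pow 2 (N.of_nat w) = N.of_nat (2 ^ w).
Proof.
elim: w => // w IH; rewrite expnS Nnat.Nat2N.inj_succ N.pow_succ_r' IH.
by rewrite -[muln]/Nat.mul Nnat.Nat2N.inj_mul.
Qed.

Lemma pack_pk b x : pack b x = N.of_nat (pk (2 ^ b) x).
Proof.
elim: x => //= a x ->; rewrite N.shiftl_mul_pow2 of_nat_pow2.
by rewrite -[muln]/Nat.mul -[addn]/Nat.add Nnat.Nat2N.inj_add Nnat.Nat2N.inj_mul.
Qed.

(** * Words with [i] zeros, their generation by insertion, and their number *)

Definition valid i m (x : seq nat) := perm_eq x (nseq i 0 ++ iota 1 m).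

Lemma size_valid i m x : valid i m x -> size x = i + m.
Proof. by move/perm_size; rewrite size_cat size_nseq size_iota. Qed.

Lemma zeros_valid i m x : valid i m x -> zeros x = i.
Proof.
move/seq.permP/(_ (eq_op 0)); rewrite /zeros => ->; rewrite count_cat count_nseq /= mul1n.
apply/eqP; rewrite -[X in _ == X]addn0 eqn_add2l -leqn0 leqNgt -has_count.
by apply/hasPn => a; rewrite mem_iota; lia.
Qed.

Lemma valid_lt i m x B : valid i m x -> m < B -> all (fun a => a < B) x.
Proof.
move=> /perm_all -> mB; rewrite all_cat all_nseq; apply/andP; split; first by lia.
by apply/allP => a; rewrite mem_iota; lia.
Qed.

Lemma perm_ins l c y : perm_eq (ins l c y) (c :: y).
Proof. by rewrite /ins perm_catC /= perm_cons perm_catC cat_take_drop. Qed.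

Lemma perm_iotaS i m :
  perm_eq (nseq i 0 ++ iota 1 m.+1) (m.+1 :: nseq i 0 ++ iota 1 m).
Proof. by rewrite -(addn1 m) iotaD catA perm_catC /= add1n addn1. Qed.

Lemma ins_valid l i m y : valid i m y -> valid i m.+1 (ins l m.+1 y).
Proof.
rewrite /valid => yv; apply: perm_trans (perm_ins _ _ _) _.
by rewrite perm_sym; apply: perm_trans (perm_iotaS _ _) _; rewrite perm_cons perm_sym.
Qed.

Lemma ins0_valid l i m y : valid i m y -> valid i.+1 m (ins l 0 y).
Proof. by rewrite /valid => yv; apply: perm_trans (perm_ins _ _ _) _; rewrite /= perm_cons. Qed.

Definition kids i m y := [seq ins l m.+1 y | l <- iota 0 (i + m).+1].

Fixpoint gen i m : seq (seq nat) :=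
  if m is m'.+1 then flatten [seq kids i m' y | y <- gen i m'] else [:: nseq i 0].

Lemma gen_valid i m x : x \in gen i m -> valid i m x.
Proof.
elim: m x => [|m IH] x /=; first by rewrite inE /valid cats0 => /eqP ->.
case/flatten_mapP => y /IH yv /mapP[l _ ->]; exact: ins_valid.
Qed.

(** Deleting the largest letter [m.+1] yields the parent of [x]; the old position of that letter
    tells where to reinsert it. *)
Lemma valid_gen i m x : valid i m x -> x \in gen i m.
Proof.
elim: m x => [|m IH] x.
  rewrite /valid cats0 => xv; rewrite inE -(size_nseq i 0) -(perm_size xv).
  apply/eqP/all_pred1P/allP => a; rewrite (perm_mem xv).
  by rewrite mem_nseq => /andP[].
move=> xv; have mx : m.+1 \in x.
  by rewrite (perm_mem xv) mem_cat mem_iota; lia.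
set l := index m.+1 x; pose y := take l x ++ drop l.+1 x.
have lx : l < size x by rewrite index_mem.
have xE : x = ins l m.+1 y.
  have szt : size (take l x) = l by rewrite size_takel // ltnW.
  rewrite /ins /y take_size_cat // drop_size_cat //.
  by rewrite -[X in X :: _](nth_index 0 mx) -drop_nth // cat_take_drop.
have yv : valid i m y.
  rewrite /valid -(perm_cons m.+1).
  apply: (@perm_trans _ (ins l m.+1 y)); first by rewrite perm_sym perm_ins.
  rewrite -xE; exact: perm_trans xv (perm_iotaS _ _).
apply/flatten_mapP; exists y; first exact: IH.
apply/mapP; exists l => //; rewrite mem_iota add0n.
by rewrite -addnS -(size_valid xv).
Qed.

Lemma size_flatten_kids i m s :
  size (flatten [seq kids i m y | y <- s]) = size s * (i + m).+1.
Proof. by elim: s => //= y s IH; rewrite size_cat IH size_map size_iota mulSn. Qed.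

(** A word of length [i + m] has [i + m + 1] children, so generation [m] has [(i + m)! / i!]
    members; the division is cleared. *)
Lemma size_gen i m : i`! * size (gen i m) = (i + m)`!.
Proof.
elim: m => [|m IH] /=; first by rewrite addn0 muln1.
by rewrite size_flatten_kids mulnA IH addnS factS mulnC.
Qed.

Lemma size_gen_gt0 i m : 0 < size (gen i m).
Proof. by have := size_gen i m; case: (size _) => //; have := fact_gt0 (i + m); lia. Qed.

Lemma sum_fact_le i d : \sum_(m < d.+1) (i + m)`! <= 2 * (i + d)`!.
Proof.
elim: d => [|d IH]; first by rewrite big_ord1 leq_pmull.
rewrite big_ord_recr /= addnS.
(* The induction needs [2 * (i + d)! <= (i + d + 1)!], which fails only for [i + d = 0]. *)
case E : (i + d) => [|e].
  have [-> ->] : i = 0 /\ d = 0 by lia.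
  by rewrite big_ord1.
rewrite E in IH; rewrite [e.+2`!]factS mul2n -addnn leq_add2r.
by apply: leq_trans IH _; rewrite leq_mul2r orbC.
Qed.

Definition level_size i n := \sum_(m < (n - i).+1) size (gen i m).

Lemma level_size_fact i n : i <= n -> i`! * level_size i n <= 2 * n`!.
Proof.
move=> ik; rewrite /level_size big_distrr /=.
under eq_bigr do rewrite size_gen.
by have := sum_fact_le i (n - i); rewrite subnKC.
Qed.

(** As [2 ^ i <= 2 * i!], the bound on the level size decays geometrically in [i]. This keeps the
    total over all levels [O(n!)], uniformly in [k]. *)
Lemma level_size_le i n : i <= n -> 2 ^ i * level_size i n <= 4 * n`!.
Proof.
move=> ik; have h2 := level_size_fact ik; have : 2 ^ i <= 2 * i`!.
  elim: i {ik h2} => // i IH; rewrite expnS factS.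
  case: i IH => // i IH; apply: leq_trans (leq_mul (leqnn 2) IH) _.
  by rewrite leq_mul2l /= leq_mul2r orbC.
move=> h1; apply: leq_trans (leq_mul h1 (leqnn _)) _.
by rewrite -mulnA (leq_trans (leq_mul (leqnn 2) h2)) // mulnA.
Qed.

(** * The word RAM on natural numbers *)

Definition unit_cost (_ : opcode) := 1.

Definition opcodes : seq opcode :=
  [:: KConst; KMove; KUn Onot; KUn Opopcount; KBin Oadd; KBin Osub; KBin Omul;
      KBin Odiv; KBin Omod; KBin Oand; KBin Oor; KBin Oxor; KBin Oshl; KBin Oshr;
      KBin Oeq; KBin Olt; KFetch; KStore; KInsert; KLookup; KTest].

Lemma cost_le_sum (cost : opcode -> nat) o : cost o <= sumn (map cost opcodes).
Proof. by case: o => [| |[]|[]| | | | |] /=; lia. Qed.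

(** Costs influence neither control flow nor the final state, so the same run is only stretched by a
    factor between 1 and [M]. *)
Lemma exec_unit_cost w cost M c s T s' : (forall o, 0 < cost o <= M) ->
  exec w unit_cost c s T s' ->
  exists2 T', exec w cost c s T' s' & T <= T' <= M * T.
Proof.
move=> hM; elim=> {c s T s'}.
- by move=> s; exists 0; [constructor|rewrite muln0].
- by move=> i s; exists (cost (opcode_of i)); [constructor|rewrite muln1 hM].
- move=> c1 c2 s1 s2 s3 T1 T2 _ [T1' e1 h1] _ [T2' e2 h2].
  by exists (T1' + T2'); [apply: exec_seq e1 e2|rewrite mulnDr; lia].
- move=> x c1 c2 s T s' hx _ [T' e h].
  exists (cost KTest + T'); first exact: exec_if_true.
  by have := hM KTest; rewrite /unit_cost mulnDr muln1; lia.
- move=> x c1 c2 s T s' hx _ [T' e h].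
  exists (cost KTest + T'); first exact: exec_if_false.
  by have := hM KTest; rewrite /unit_cost mulnDr muln1; lia.
- move=> x c s1 s2 s3 T1 T2 hx _ [T1' e1 h1] _ [T2' e2 h2].
  exists (cost KTest + T1' + T2'); first exact: exec_while_true e1 e2.
  by have := hM KTest; rewrite /unit_cost !mulnDr muln1; lia.
- move=> x c s hx; exists (cost KTest); first exact: exec_while_false.
  by rewrite muln1 hM.
Qed.

(** Source of the lower bound: an instruction adds at most one key to a table and takes at least one
    unit of time. *)
Lemma count_keys_le_time w cost c s T s' t (L : seq N) : (forall o, 0 < cost o) ->
  uniq L -> exec w cost c s T s' ->
  count (fun key => table s' t key) L <= count (fun key => table s t key) L + T.
Proof.
move=> hc uL; elim=> {c s T s'} //; try by intros; lia.
move=> i s.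
have h := hc (opcode_of i).
case: i h => [d c|d x|o d x|o d x y|d a|a x|t' key x|d f t' key] /= h;
  try exact: leq_addr.
  apply: (@leq_trans (count (predU (fun key => table s t key) (pred1 (reg s key))) L)).
    apply: sub_count => z /=; case: ifP => [/andP[_ /N.eqb_eq ->] _|_ -> //].
    by rewrite eqxx orbT.
  have := count_predUI (fun key => table s t key) (pred1 (reg s key)) L.
  by rewrite [count (pred1 _) _]count_uniq_mem //; case: (_ \in _) => /=; lia.
by case: (table s _ _) => [v|] /=; apply: leq_addr.
Qed.

(** * Simulation of machine states by natural numbers *)

Record cfg := Cfg {
  er : seq nat;
  em : nat -> nat;
  et : nat -> nat -> option nat }.

(** Registers past the end of the list read as zero; with a concrete list, straight-line code is
    executed by computation. *)
Definition sim (s : state) (g : cfg) : Prop :=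
  [/\ forall r, reg s r = N.of_nat (nth 0 (er g) r),
      forall a, Defs.mem s (N.of_nat a) = N.of_nat (em g a) &
      forall t key, table s (N.of_nat t) (N.of_nat key) =
        omap N.of_nat (et g t key)].

Definition arith (o : binop) : bool :=
  match o with
  | Oadd | Osub | Omul | Odiv | Omod | Oeq | Olt => true
  | _ => false
  end.

Definition nbin (w : nat) (o : binop) (x y : nat) : nat :=
  match o with
  | Oadd => x + y
  | Osub => x + 2 ^ w - y
  | Omul => x * y
  | Odiv => x %/ y
  | Omod => x %% y
  | Oeq => x == y
  | Olt => x < y
  | _ => 0
  end %% 2 ^ w.

Definition modelled (i : instr) : bool :=
  match i with Un _ _ _ => false | Bin o _ _ _ => arith o | _ => true end.

Definition upd (g : cfg) d v := Cfg (set_nth 0 (er g) d v) (em g) (et g).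

Definition nstep w (i : instr) (g : cfg) : cfg :=
  let r := nth 0 (er g) in
  match i with
  | Const d c => upd g d (N.to_nat c %% 2 ^ w)
  | Move d x => upd g d (r x)
  | Un _ _ _ => g
  | Bin o d x y => upd g d (nbin w o (r x) (r y))
  | Fetch d a => upd g d (em g (r a))
  | Store a x => Cfg (er g) (fun b => if b == r a then r x else em g b) (et g)
  | Insert t key x =>
      Cfg (er g) (em g) (fun t' key' =>
        if (t' == r t) && (key' == r key) then Some (r x) else et g t' key')
  | Lookup d f t key =>
      upd (upd g d (odflt 0 (et g (r t) (r key)))) f (isSome (et g (r t) (r key)))
  end.

Lemma of_nat_edivn x y : 0 < y ->
  N.of_nat x = (N.of_nat y * N.of_nat (x %/ y) + N.of_nat (x %% y))%num /\
  (N.of_nat (x %% y) < N.of_nat y)%num.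
Proof.
move=> y0; have := divn_eq x y; have := ltn_mod x y; rewrite y0.
move: (x %/ y) (x %% y) => q r; nia.
Qed.

Lemma of_nat_div x y : N.of_nat (x %/ y) = N.div (N.of_nat x) (N.of_nat y).
Proof.
case: y => [|y]; first by rewrite divn0; case: x.
by have [E lt] := @of_nat_edivn x y.+1 isT; apply: N.div_unique lt E.
Qed.

Lemma of_nat_mod x y : N.of_nat (x %% y) = N.modulo (N.of_nat x) (N.of_nat y).
Proof.
case: y => [|y]; first by rewrite modn0; case: x.
by have [E lt] := @of_nat_edivn x y.+1 isT; apply: N.mod_unique lt E.
Qed.

Lemma of_nat_eqb x y : N.eqb (N.of_nat x) (N.of_nat y) = (x == y).
Proof. lia. Qed.

Lemma of_nat_ltb x y : N.ltb (N.of_nat x) (N.of_nat y) = (x < y).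
Proof. lia. Qed.

Lemma eval_binop_nat w o x y : arith o ->
  eval_binop w o (N.of_nat x) (N.of_nat y) = N.of_nat (nbin w o x y).
Proof.
rewrite /eval_binop /nbin /Defs.wrap of_nat_pow2 of_nat_mod.
case: o => // _; congr N.modulo; rewrite ?of_nat_eqb ?of_nat_ltb ?of_nat_pow2 //.
- by rewrite Nnat.Nat2N.inj_add.
- by rewrite Nnat.Nat2N.inj_sub Nnat.Nat2N.inj_add.
- by rewrite Nnat.Nat2N.inj_mul.
- by rewrite of_nat_div.
- by rewrite of_nat_mod.
- by case: eqP.
- by case: ltnP.
Qed.

Lemma sim_upd s g d v : sim s g -> sim (set_reg s d (N.of_nat v)) (upd g d v).
Proof.
by case=> hr hm ht; split=> // r /=; rewrite nth_set_nth /=; case: eqP.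
Qed.

Lemma wrap_nat w c : Defs.wrap w c = N.of_nat (N.to_nat c %% 2 ^ w).
Proof. by rewrite of_nat_mod Nnat.N2Nat.id /Defs.wrap of_nat_pow2. Qed.

Lemma sim_step w i s g : modelled i -> sim s g -> sim (step w i s) (nstep w i g).
Proof.
move=> hi S; have [hr hm ht] := S.
case: i hi => [d c|d x|//|o d x y|d a|a x|t key x|d f t key] /= hi.
- by rewrite wrap_nat; apply: sim_upd.
- by rewrite hr; apply: sim_upd.
- by rewrite !hr eval_binop_nat //; apply: sim_upd.
- by rewrite hr hm; apply: sim_upd.
- by split=> // b /=; rewrite !hr of_nat_eqb; case: eqP.
- by split=> // t' key' /=; rewrite !hr !of_nat_eqb; case: ifP.
rewrite !hr ht; case: (et g _ _) => [v|] /=.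
  by apply: (@sim_upd _ _ f 1); apply: sim_upd.
by apply: (@sim_upd _ _ f 0); apply: (@sim_upd _ _ d 0).
Qed.

(** A Hoare triple for total correctness with a time bound at unit cost, for every state simulated
    by [g]. *)
Definition Run w c (g : cfg) (N : nat) (Q : cfg -> Prop) : Prop :=
  forall s, sim s g -> exists T s',
    [/\ exec w unit_cost c s T s', T <= N & exists2 g', sim s' g' & Q g'].

Lemma run_skip w g N (Q : cfg -> Prop) : Q g -> Run w Skip g N Q.
Proof. by move=> q s S; exists 0, s; split=> //; [constructor|exists g]. Qed.

Lemma run_weaken w c g N N' (Q Q' : cfg -> Prop) :
  Run w c g N Q -> N <= N' -> (forall g', Q g' -> Q' g') -> Run w c g N' Q'.
Proof.
move=> H NN QQ s /H[T [s' [e TN [g' S q]]]]; exists T, s'; split=> //.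
  exact: leq_trans TN NN.
by exists g' => //; apply: QQ.
Qed.

Lemma run_seq w c1 c2 g N1 N2 (Q1 Q : cfg -> Prop) :
  Run w c1 g N1 Q1 -> (forall g', Q1 g' -> Run w c2 g' N2 Q) ->
  Run w (Seq c1 c2) g (N1 + N2) Q.
Proof.
move=> H1 H2 s /H1[T1 [s1 [e1 h1 [g1 S1 /H2/(_ _ S1)[T2 [s2 [e2 h2 q]]]]]]].
by exists (T1 + T2), s2; split=> //; [apply: exec_seq e1 e2|apply: leq_add].
Qed.

Lemma run_do w i c g N (Q : cfg -> Prop) : modelled i ->
  Run w c (nstep w i g) N Q -> Run w (Seq (Do i) c) g N.+1 Q.
Proof.
move=> hi H s S; have [T [s' [e h q]]] := H _ (sim_step w hi S).
by exists T.+1, s'; split=> //; rewrite -add1n; apply: exec_seq e; constructor.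
Qed.

Lemma run_if w x c1 c2 g N (Q : cfg -> Prop) :
  Run w (if nth 0 (er g) x == 0 then c2 else c1) g N Q ->
  Run w (If x c1 c2) g N.+1 Q.
Proof.
move=> H s S; have [T [s' [e h q]]] := H _ S; exists T.+1, s'; split=> //.
case: S => hr _ _; rewrite -add1n; case: eqP e => E e.
  by apply: exec_if_false e; rewrite hr E.
by apply: exec_if_true e; rewrite hr; lia.
Qed.

Lemma run_while w x c (Inv : nat -> cfg -> Prop) (C : nat -> nat) L g : Inv 0 g ->
  (forall j g, j < L -> Inv j g ->
     nth 0 (er g) x != 0 /\ Run w c g (C j) (Inv j.+1)) ->
  (forall g, Inv L g -> nth 0 (er g) x = 0) ->
  Run w (While x c) g (\sum_(j < L) (C j).+1).+1 (Inv L).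
Proof.
(* Induction on the number [d] of iterations left; the last unit of time is the failing test. *)
move=> I0 Hs He; suff H d j g' : j + d = L -> Inv j g' ->
    Run w (While x c) g' (\sum_(j <= i < L) (C i).+1).+1 (Inv L).
  by rewrite -(big_mkord xpredT (fun j => (C j).+1)); apply: (H L).
elim: d j g' => [|d IH] j g'.
  rewrite addn0 => -> I s S; exists 1, s.
  split=> //; last by exists g'.
  by apply: exec_while_false; case: S => -> _ _; rewrite (He _ I).
rewrite addnS => jL I; have jltL : j < L by lia.
have [nz Hc] := Hs _ _ jltL I.
move=> s S; have [T1 [s1 [e1 h1 [g1 S1 I1]]]] := Hc _ S.
have [T2 [s2 [e2 h2 q]]] := IH j.+1 g1 jL I1 _ S1.
exists (1 + T1 + T2), s2; split=> //.
  by apply: exec_while_true e1 e2; case: S => -> _ _; lia.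
by rewrite big_ltn //; move: h1 h2; lia.
Qed.

Fixpoint block (is_ : seq instr) (c : cmd) : cmd :=
  if is_ is i :: r then Seq (Do i) (block r c) else c.

Arguments block : simpl never.

Lemma run_block w is_ c g N (Q : cfg -> Prop) : all modelled is_ ->
  Run w c (foldl (fun g i => nstep w i g) g is_) N Q ->
  Run w (block is_ c) g (size is_ + N) Q.
Proof.
by elim: is_ g => //= i r IH g /andP[hi /IH H] /H{H}; apply: run_do.
Qed.

(** * The program *)

(* Registers: 0 n, 1 k, 2 one, 3 zero, 4 n + 1, 5 letter base B, 6 top level,
   7 level i, 8 flag of the level loop, 9 i + 1, 10 rank of the letter k - i,
   11-15 scratch, 16 and 17 queue segment of the current length, 18 queue end,
   19 letter to insert, 20 current length, 21 its successor, 22 and 23 flags,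
   24 count of the current word, which is split at position 29 into the prefix 25
   and the suffix 26, 27 the weight of that position, 28 zeros of the prefix,
   30 flag. *)

Definition kids_body : cmd :=
  block [:: Bin Omul 11 26 5; Bin Oadd 12 19 11; Bin Omul 12 27 12;
    Bin Oadd 12 25 12; Store 18 12; Bin Oadd 18 18 2; Bin Oeq 15 28 10; Move 13 24]
 (Seq (If 15 (block [:: Bin Omul 14 27 11; Bin Oadd 14 25 14; Lookup 14 15 9 14;
    Bin Oadd 13 13 14] Skip) Skip)
 (block [:: Insert 7 12 13; Bin Omod 11 26 5; Bin Odiv 26 26 5; Bin Omul 14 27 11;
    Bin Oadd 25 25 14; Bin Omul 27 27 5; Bin Oeq 15 11 3; Bin Oadd 28 28 15;
    Bin Oadd 29 29 2; Bin Olt 30 29 21] Skip)).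

(** Takes the next word off the queue and splits it at position 0: empty prefix, weight 1, whole
    word as suffix. *)
Definition words_body : cmd :=
  block [:: Fetch 26 16; Lookup 24 15 7 26; Const 25 0; Const 27 1; Const 28 0;
    Const 29 0; Const 30 1]
 (Seq (While 30 kids_body)
 (block [:: Bin Oadd 16 16 2; Bin Olt 23 16 17] Skip)).

(** Words of the next length are appended behind the current segment, so the next segment runs from
    its end to the queue end. *)
Definition lengths_body : cmd :=
  block [:: Bin Oadd 21 20 2; Const 23 1]
 (Seq (While 23 words_body)
 (block [:: Move 17 18; Bin Oadd 19 19 2; Bin Oadd 20 20 2; Bin Olt 22 20 0] Skip)).

(** Register 14 stays 1 until the letter [k - i] has been met, so only larger letters in front of it
    are counted. *)
Definition scan_body : cmd :=
  block [:: Fetch 13 12; Bin Oeq 15 13 11; Bin Oeq 15 15 3; Bin Omul 14 14 15;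
    Bin Olt 15 11 13; Bin Omul 15 15 14; Bin Oadd 10 10 15; Bin Oadd 12 12 2;
    Bin Olt 15 12 6] Skip.

(** Level [i] fills table [i] and has its queue from address [n] on, behind the pattern letters that
    get scanned. Its seed, the word of [i] zeros, is packed as 0. *)
Definition level_body : cmd :=
  block [:: Bin Osub 11 1 7; Const 10 0; Const 12 0; Const 14 1; Bin Olt 15 12 6]
 (Seq (While 15 scan_body)
 (block [:: Bin Oadd 9 7 2; Const 11 0; Store 0 11; Bin Oeq 12 7 1; Insert 7 11 12;
    Move 16 0; Move 17 4; Move 18 4; Const 19 1; Move 20 7; Bin Olt 22 20 0]
 (Seq (While 22 lengths_body)
 (block [:: Bin Olt 8 3 7]
 (If 8 (block [:: Bin Osub 7 7 2] Skip) Skip))))).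

Definition base_body : cmd := block [:: Bin Oadd 5 5 5; Bin Olt 15 5 4] Skip.

(** For [n <= 1] the only permutation is packed as [n] itself and has one hit exactly when [k <= n].
    Treating this apart avoids [n + 1], which may overflow a one-bit word. *)
Definition prog : cmd :=
  block [:: Const 2 1; Bin Olt 15 2 0]
  (If 15
    (block [:: Bin Oadd 4 0 2; Const 5 1; Bin Olt 15 5 4]
    (Seq (While 15 base_body)
    (block [:: Bin Olt 15 1 4]
    (Seq (If 15 (block [:: Move 6 1] Skip) Skip)
    (block [:: Move 7 6; Const 8 1]
    (While 8 level_body))))))
    (block [:: Bin Olt 15 0 1; Bin Oeq 15 15 3; Insert 3 0 15] Skip)).

(** * Correctness and running time *)

Lemma pk_drop B y l : pk B (drop l y) = nth 0 y l + pk B (drop l.+1 y) * B.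
Proof.
case: (ltnP l (size y)) => h; first by rewrite (drop_nth 0 h).
by rewrite nth_default // !drop_oversize // ltnW.
Qed.

(** After the last letter the program still reads one digit, a 0, from the exhausted suffix; the
    appended zero accounts for it. *)
Lemma take_rcons0 l (y : seq nat) : l <= size y ->
  take l (rcons y 0) = take l y /\ take l.+1 (rcons y 0) = rcons (take l y) (nth 0 y l).
Proof.
move=> ly; have E : take l (rcons y 0) = take l y by rewrite -cats1 takel_cat.
split=> //; rewrite (take_nth 0) ?size_rcons // nth_rcons E.
by case: ltnP => // h; rewrite [nth 0 y l]nth_default //; case: eqP.
Qed.

Lemma pk_ins B l c y : l <= size y ->
  pk B (ins l c y) = pk B (take l y) + B ^ l * (c + pk B (drop l y) * B).
Proof. by move=> ly; rewrite /ins pk_cat size_takel. Qed.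

Lemma modn_bool_word w (b : bool) : 0 < w -> b %% 2 ^ w = b.
Proof.
case: w => // v _; apply: modn_small; apply: leq_ltn_trans (leq_b1 b) _.
by rewrite (ltn_exp2l 0 v.+1).
Qed.

(** * One level of the recurrence *)

Section Level.

Variables (w n k B K i a go : nat) (f : seq nat -> nat).
Variables (m0 : nat -> nat) (t0 : nat -> nat -> option nat).
Hypothesis w_gt0 : 0 < w.
Hypothesis n_gt1 : 1 < n.
Hypothesis nB : n < B.
Hypothesis BW : B ^ n <= 2 ^ w.
Hypothesis nW : n.+2 < 2 ^ w.
Hypothesis i_le_n : i <= n.
Hypothesis fW : forall x, size x <= n -> f x < 2 ^ w.
Hypothesis f_ins : forall m y l, valid i m y -> i + m < n -> l <= i + m ->
  f (ins l m.+1 y) =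
  f y + (zeros (take l y) == a) * odflt 0 (t0 i.+1 (pk B (ins l 0 y))).

Let modn_bool b := modn_bool_word b w_gt0.

Definition regs t1 t2 t3 t4 t5 lo hi tail le len len1 c c1 fy pre suf pw z l c2 :=
  [:: n; k; 1; 0; n.+1; B; K; i; go; i.+1; a; t1; t2; t3; t4; t5; lo; hi; tail; le;
      len; len1; c; c1; fy; pre; suf; pw; z; l; c2].

(** [Q] holds all words enqueued so far in level [i], including those already expanded. The pattern
    cells below [n] and the tables of the other levels are preserved. *)
Definition queue (Q : seq (seq nat)) (mm : nat -> nat) (tt : nat -> nat -> option nat) :=
  [/\ forall j, j < n -> mm j = m0 j,
      forall j, j < size Q -> mm (n + j) = pk B (nth [::] Q j),
      forall x, x \in Q -> tt i (pk B x) = Some (f x),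
      forall x, x \in Q -> exists2 m, i + m <= n & valid i m x &
      forall j key, j != i -> tt j key = t0 j key].

Lemma queue_rcons Q mm tt m x : queue Q mm tt -> i + m <= n -> valid i m x ->
  queue (rcons Q x) (fun b => if b == n + size Q then pk B x else mm b)
    (fun t key => if (t == i) && (key == pk B x) then Some (f x) else tt t key).
Proof.
have lt_base m' : i + m' <= n -> m' < B.
  by move=> h; apply: leq_ltn_trans (leq_trans (leq_addl i m') h) nB.
case=> q1 q2 q3 q4 q5 imn xv; split.
- by move=> j jn; rewrite ltn_eqF ?q1 // ltn_addr.
- move=> j; rewrite size_rcons ltnS nth_rcons eqn_add2l => jQ.
  by case: ltngtP jQ => // jQ _; rewrite q2.
- move=> z; rewrite mem_rcons inE eqxx /= => /predU1P[->|zQ]; first by rewrite eqxx.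
  (* If the new key is already present, both words have [i] zeros, hence are equal, and the old
     value is overwritten by itself. *)
  case: eqP => [E|_]; last exact: q3.
  have [m' im'n zv] := q4 _ zQ; congr (Some (f _)); apply/esym.
  apply: pk_inj E; [exact: valid_lt zv (lt_base _ _)|exact: valid_lt xv (lt_base _ _)|].
  by rewrite (zeros_valid zv) (zeros_valid xv).
- by move=> z; rewrite mem_rcons inE => /predU1P[->|/q4 //]; exists m.
by move=> j key ji; rewrite (negPf ji) q5.
Qed.

Section Kids.

Variables (Q : seq (seq nat)) (m lo hi c c1 : nat) (y : seq nat).
Hypothesis yv : valid i m y.
Hypothesis imn : i + m < n.
Hypothesis QW : n + size Q + (i + m).+1 < 2 ^ w.

(** The weight is reduced modulo [2 ^ w] because it can equal [2 ^ w] on exit; while the loop runs,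
    [l < n] and [B ^ l] is exact. *)
Definition kids_inv l (g : cfg) := exists t1 t2 t3 t4 t5 mm tt,
  g = Cfg (regs t1 t2 t3 t4 t5 lo hi (n + size Q + l) m.+1 (i + m) (i + m).+1 c c1
        (f y) (pk B (take l (rcons y 0))) (pk B (drop l y)) (B ^ l %% 2 ^ w)
        (zeros (take l (rcons y 0))) l (l < (i + m).+1)) mm tt /\
  queue (Q ++ [seq ins j m.+1 y | j <- iota 0 l]) mm tt.

Lemma pk_ins_lt l c' : c' <= m.+1 -> pk B (ins l c' y) < 2 ^ w.
Proof.
move=> cm; apply: leq_trans BW; apply: leq_trans (pk_lt _) _.
  rewrite (perm_all _ (perm_ins l c' y)) /=; apply/andP; split; first lia.
  by apply: valid_lt yv _; lia.
rewrite (perm_size (perm_ins l c' y)) /= (size_valid yv).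
by rewrite leq_exp2l //; lia.
Qed.

Lemma kids_step l g : l < (i + m).+1 -> kids_inv l g ->
  nth 0 (er g) 30 != 0 /\ Run w kids_body g 30 (kids_inv l.+1).
Proof.
move=> li [t1 [t2 [t3 [t4 [t5 [mm [tt [-> q]]]]]]]].
split; first by rewrite /= li.
have ly : l <= size y by rewrite (size_valid yv).
have [-> tE] := take_rcons0 ly.
have B1 : 1 < B by lia.
have PW : B ^ l %% 2 ^ w = B ^ l.
  by rewrite modn_small // (leq_trans _ BW) // ltn_exp2l //; lia.
have P0 : 0 < B ^ l by rewrite expn_gt0; lia.
have c1W := pk_ins_lt l (leqnn m.+1); have c0W := pk_ins_lt l (leq0n m.+1).
rewrite pk_ins // in c1W; rewrite pk_ins // add0n in c0W.
set S := pk B (drop l y) * B in c1W c0W *.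
have h1 : m.+1 + S < 2 ^ w.
  by apply: leq_ltn_trans c1W; rewrite (leq_trans _ (leq_addl _ _)) // leq_pmull.
have h2 : B ^ l * (m.+1 + S) < 2 ^ w.
  by apply: leq_ltn_trans c1W; rewrite leq_addl.
have h0 : B ^ l * S < 2 ^ w by apply: leq_ltn_trans c0W; rewrite leq_addl.
have h3 : S < 2 ^ w by apply: leq_ltn_trans h1; rewrite leq_addl.
have h4 : n + size Q + l + 1 < 2 ^ w by lia.
rewrite /kids_body; apply: (@run_weaken _ _ _ (8 + (6 + 10)) _ (kids_inv l.+1)) => //.
apply: run_block => //.
rewrite /regs /= /upd /nbin /= PW -/S (modn_small h3) (modn_small h1) (modn_small h2).
rewrite (modn_small c1W) (modn_small h4) modn_bool.
pose child := pk B (take l y) + B ^ l * (m.+1 + S).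
have childE : child = pk B (ins l m.+1 y) by rewrite pk_ins.
pose mm' := fun b => if b == n + size Q + l then child else mm b.
have fE := f_ins yv imn (li : l <= i + m).
have fvW : f (ins l m.+1 y) < 2 ^ w.
  by apply: fW; rewrite (perm_size (perm_ins _ _ _)) /= (size_valid yv).
(* Both branches of the conditional leave the count of the child in register 13. *)
apply: (@run_seq _ _ _ _ _ _ (fun g' => exists t4 t5, g' =
  Cfg (regs S child (f (ins l m.+1 y)) t4 t5 lo hi (n + size Q + l + 1) m.+1 (i + m)
    (i + m).+1 c c1 (f y) (pk B (take l y)) (pk B (drop l y)) (B ^ l)
    (zeros (take l y)) l (l < (i + m).+1)) mm' tt)).
  apply: (@run_if _ _ _ _ _ 5); rewrite /=; move: fE; case: (zeros _ =P a) => /= za.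
    rewrite mul1n => fE; apply: (@run_block _ _ _ _ 1) => //.
    rewrite /= /upd /nbin /= (modn_small h0) (modn_small c0W).
    (* The lookup concerns table [i.+1], which this level leaves untouched. *)
    have -> : tt i.+1 (pk B (take l y) + B ^ l * S) = t0 i.+1 (pk B (ins l 0 y)).
      by case: q => _ _ _ _ ->; rewrite ?pk_ins // neq_ltn ltnSn orbT.
    by apply: run_skip; rewrite -fE (modn_small fvW); do 2!eexists.
  by rewrite mul0n addn0 => fE; apply: run_skip; rewrite -fE; do 2!eexists.
move=> {}g [{}t4 [{}t5 ->]]; apply: (@run_block _ _ _ _ 0) => //.
have dB : nth 0 y l < B.
  case: (ltnP l (size y)) => h; last by rewrite nth_default //; lia.
  have /allP := valid_lt yv (leq_ltn_trans (leq_addl i m) (ltn_trans imn nB)); apply.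
  exact: mem_nth.
have B0 : 0 < B by lia.
have E1 : pk B (drop l y) %% B = nth 0 y l by rewrite pk_drop addnC modnMDl modn_small.
have E2 : pk B (drop l y) %/ B = pk B (drop l.+1 y).
  by rewrite pk_drop addnC divnMDl // divn_small // addn0.
rewrite /= /upd /nbin /= E1 E2.
(* The remaining intermediate values are dominated by ones already known to fit in a word. *)
have dS : nth 0 y l <= S.
  rewrite /S; apply: (@leq_trans (pk B (drop l y))); last exact: leq_pmulr.
  by rewrite pk_drop leq_addr.
have rS : pk B (drop l.+1 y) <= S.
  rewrite /S; apply: (@leq_trans (pk B (drop l y))); last exact: leq_pmulr.
  by rewrite (pk_drop B y l) (leq_trans _ (leq_addl _ _)) // leq_pmulr.
have PdS : B ^ l * nth 0 y l <= B ^ l * S by rewrite leq_mul2l dS orbT.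
have zl : zeros (take l y) <= n.
  by rewrite (leq_trans (count_size _ _)) // size_takel //; lia.
rewrite (modn_small (leq_ltn_trans dS h3)) (modn_small (leq_ltn_trans rS h3)).
rewrite (modn_small (leq_ltn_trans PdS h0)) !modn_bool.
rewrite [(pk B _ + _) %% _]modn_small; last first.
  by apply: leq_ltn_trans c0W; rewrite leq_add2l.
rewrite [(zeros _ + _) %% _]modn_small; last first.
  by apply: (@leq_ltn_trans (n + 1)); [rewrite leq_add ?leq_b1|lia].
rewrite [(l + 1) %% _]modn_small; last by lia.
have E3 : pk B (take l.+1 (rcons y 0)) = pk B (take l y) + B ^ l * nth 0 y l.
  by rewrite tE -cats1 pk_cat size_takel //= mul0n addn0.
have E4 : zeros (take l.+1 (rcons y 0)) = zeros (take l y) + (nth 0 y l == 0).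
  by rewrite tE -cats1 zeros_cat /zeros /= addn0 (eq_sym 0).
rewrite -expnSr -[n + size Q + l + 1]addnA addn1 -E3 -E4.
apply: run_skip; do 7!eexists; split; first by [].
rewrite -(addn1 l) iotaD map_cat catA cats1 /mm' childE.
have -> : n + size Q + l = n + size (Q ++ [seq ins j m.+1 y | j <- iota 0 l]).
  by rewrite size_cat size_map size_iota addnA.
by apply: queue_rcons q _ (ins_valid l yv); rewrite addnS.
Qed.

Lemma kids_loop g : kids_inv 0 g ->
  Run w (While 30 kids_body) g (31 * (i + m).+1).+1 (kids_inv (i + m).+1).
Proof.
move=> I0; have := run_while I0 (C := fun=> 30) kids_step.
rewrite sum_nat_const card_ord mulnC; apply=> g'.
by case=> [? [? [? [? [? [? [? [-> _]]]]]]]]; rewrite /= ltnn.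
Qed.

End Kids.

Hypothesis level_W : n + level_size i n < 2 ^ w.

(** The queue lists the generations in order; the size of this prefix is the offset at which
    generation [d] starts. *)
Fixpoint upto d := if d is e.+1 then upto e ++ gen i e else [::].

Lemma size_upto d : i + d <= n.+1 -> size (upto d) <= level_size i n.
Proof.
move=> idn; have -> : size (upto d) = \sum_(m < d) size (gen i m).
  elim: d {idn} => [|d IH]; first by rewrite big_ord0.
  by rewrite /= size_cat IH big_ord_recr.
rewrite /level_size; have -> : (n - i).+1 = d + (n.+1 - (i + d)) by lia.
by rewrite big_split_ord leq_addr.
Qed.

Section Words.

Variables (m c : nat).
Hypothesis imn : i + m < n.

Definition words_inv j (g : cfg) :=
  exists t1 t2 t3 t4 t5 fy pre suf pw z l c2 mm tt,
  let Q := (upto m ++ gen i m) ++ flatten [seq kids i m y | y <- take j (gen i m)] in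
  g = Cfg (regs t1 t2 t3 t4 t5 (n + size (upto m) + j) (n + size (upto m ++ gen i m))
        (n + size Q) m.+1 (i + m) (i + m).+1 c (j < size (gen i m))
        fy pre suf pw z l c2) mm tt /\ queue Q mm tt.

Lemma words_step j g : j < size (gen i m) -> words_inv j g ->
  nth 0 (er g) 23 != 0 /\
  Run w words_body g (31 * (i + m).+1 + 10) (words_inv j.+1).
Proof.
move=> jg [t1 [t2 [t3 [t4 [t5 [fy [pre [suf [pw [z [l [c2 [mm [tt]]]]]]]]]]]]]] /=.
set Q := (_ ++ flatten _) => -[-> q]; split; first by rewrite /= jg.
set y := nth [::] (gen i m) j.
have yg : y \in gen i m by apply: mem_nth.
have yv := gen_valid yg.
have yQ : y \in Q by rewrite !mem_cat yg orbT.
have Ey : mm (n + size (upto m) + j) = pk B y.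
  case: q => _ q2 _ _ _; rewrite -addnA q2.
    by rewrite /Q -catA nth_cat ltnNge leq_addr /= addKn nth_cat jg.
  by rewrite /Q !size_cat; lia.
have Ef : tt i (pk B y) = Some (f y) by case: q => _ _ ->.
have szQ : size Q = size (upto m ++ gen i m) + j * (i + m).+1.
  by rewrite /Q (size_cat (_ ++ _)) size_flatten_kids size_takel // ltnW.
have h1 : 1 %% 2 ^ w = 1 by rewrite modn_small //; lia.
(* The children of the first [j.+1] words are part of generation [m.+1], so the queue still fits
   inside [upto m.+2]. *)
have QW : n + size Q + (i + m).+1 < 2 ^ w.
  apply: leq_ltn_trans level_W; rewrite -addnA leq_add2l szQ.
  have : size (upto m.+2) <= level_size i n by apply: size_upto; lia.
  rewrite /= (size_cat (_ ++ _)) size_flatten_kids; apply: leq_trans.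
  rewrite -addnA leq_add2l addnC -mulSn.
  by rewrite leq_mul2r jg orbT.
apply: (@run_weaken _ _ _ (7 + ((31 * (i + m).+1).+1 + 2)) _ (words_inv j.+1)) => //.
  apply: run_block => //.
  rewrite /= /upd /nbin /= Ey Ef /= h1 mod0n.
  apply: run_seq.
    apply: (@kids_loop Q m (n + size (upto m) + j) (n + size (upto m ++ gen i m)) c
      (j < size (gen i m)) y) => //.
    do 7!eexists; split; last by rewrite cats0; exact: q.
    by rewrite take0 drop0 expn0 h1 addn0 /=.
  move=> {Ey Ef q} {}g [{}t1 [{}t2 [{}t3 [{}t4 [{}t5 [{}mm [{}tt [-> {}q]]]]]]]].
  apply: (@run_block _ _ _ _ 0) => //.
  rewrite /= /upd /nbin /= [(_ + 1) %% _]modn_small; last first.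
    by move: QW; rewrite szQ size_cat; lia.
  rewrite modn_bool -addnA addn1.
  have -> : (n + size (upto m) + j.+1 < n + size (upto m ++ gen i m)) =
            (j.+1 < size (gen i m)) by rewrite size_cat addnA ltn_add2l.
  have QE : (upto m ++ gen i m) ++ flatten [seq kids i m z | z <- take j.+1 (gen i m)]
      = Q ++ kids i m y.
    by rewrite (take_nth [::] jg) map_rcons flatten_rcons catA.
  apply: run_skip; do 14!eexists; rewrite QE; split; last exact: q.
  by rewrite (size_cat Q) size_map size_iota addnA.
by lia.
Qed.

Lemma words_loop g : words_inv 0 g ->
  Run w (While 23 words_body) g (size (gen i m) * (31 * (i + m).+1 + 11)).+1
    (words_inv (size (gen i m))).
Proof.
move=> I0; have := run_while I0 (C := fun=> 31 * (i + m).+1 + 10) words_step.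
rewrite sum_nat_const card_ord -addnS; apply=> g'.
case=> ? [? [? [? [? [? [? [? [? [? [? [? [? [? [-> _]]]]]]]]]]]]]].
by rewrite /= ltnn.
Qed.

End Words.

Definition lengths_inv d (g : cfg) :=
  exists t1 t2 t3 t4 t5 len1 c1 fy pre suf pw z l c2 mm tt,
  let Q := upto d ++ gen i d in
  g = Cfg (regs t1 t2 t3 t4 t5 (n + size (upto d)) (n + size Q) (n + size Q) d.+1
        (i + d) len1 (i + d < n) c1 fy pre suf pw z l c2) mm tt /\ queue Q mm tt.

Lemma lengths_step d g : d < n - i -> lengths_inv d g ->
  nth 0 (er g) 22 != 0 /\
  Run w lengths_body g (31 * size (gen i d.+1) + 18 * size (gen i d)) (lengths_inv d.+1).
Proof.
move=> din [t1 [t2 [t3 [t4 [t5 [len1 [c1 [fy [pre [suf [pw [z [l [c2 [mm [tt]]]]]]]]]]]]]]]].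
set Q := (_ ++ _) => /= -[-> q].
have idn : i + d < n by lia.
split; first by rewrite /= idn.
apply: (@run_weaken _ _ _
  (2 + ((size (gen i d) * (31 * (i + d).+1 + 11)).+1 + 4)) _ (lengths_inv d.+1)) => //.
  apply: run_block => //.
  rewrite /= /upd /nbin /= (modn_bool true) modn_small addn1; last by lia.
  apply: run_seq.
    apply: (@words_loop d true idn).
    do 14!eexists; split; last by rewrite take0 cats0; exact: q.
    by rewrite take0 cats0 addn0 size_gen_gt0 idn.
  move=> {q} {}g [{}t1 [{}t2 [{}t3 [{}t4 [{}t5 [{}fy [{}pre [{}suf [{}pw [{}z [{}l
    [{}c2 [{}mm [{}tt]]]]]]]]]]]]]] /= [-> {}q].
  apply: (@run_block _ _ _ _ 0) => //.
  rewrite take_size in q *.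
  rewrite /= /upd /nbin /= modn_bool.
  rewrite [(d.+1 + 1) %% _]modn_small ?[(i + d + 1) %% _]modn_small; try lia.
  rewrite -addnA !addn1.
  apply: run_skip; do 16!eexists; split; last exact: q.
  by rewrite -size_cat addnS.
rewrite /= size_flatten_kids.
(* The constant overhead 7 is absorbed into [7 * s], as [s] is positive. *)
have := size_gen_gt0 i d; set s := size _; rewrite mulnDr [s * (31 * _)]mulnCA; lia.
Qed.

(** Charge 31 to each word when it is generated and 19 when it is expanded; either sum is at most
    the level size. *)
Lemma lengths_loop g : lengths_inv 0 g ->
  Run w (While 22 lengths_body) g (50 * level_size i n).+1 (lengths_inv (n - i)).
Proof.
move=> I0; have H := run_while I0 lengths_step.
apply: (run_weaken (H _)) => // [g'|].
  case=> ? [? [? [? [? [? [? [? [? [? [? [? [? [? [? [? [-> _]]]]]]]]]]]]]]]].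
  by rewrite /= subnKC // ltnn.
rewrite ltnS.
apply: (@leq_trans (\sum_(j < n - i) (31 * size (gen i j.+1) + 19 * size (gen i j)))).
  by apply: leq_sum => j _; have := size_gen_gt0 i j; lia.
rewrite big_split /= -!big_distrr /= (_ : 50 = 31 + 19) // mulnDl.
apply: leq_add; rewrite leq_mul2l /=.
  by rewrite /level_size big_ord_recl leq_addl.
by rewrite /level_size big_ord_recr leq_addr.
Qed.

End Level.

Lemma nbin_sub w x y : y <= x -> x < 2 ^ w -> nbin w Osub x y = x - y.
Proof.
move=> yx xW; rewrite /nbin addnC -addnBA // modnDl modn_small //.
exact: leq_ltn_trans (leq_subr _ _) xW.
Qed.

Lemma sum_geometric_le K A (L : nat -> nat) : (forall i, i <= K -> 2 ^ i * L i <= A) ->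
  \sum_(i < K.+1) L i <= 2 * A.
Proof.
(* The extra [A] is the missing tail of the geometric series; it makes the induction go through. *)
move=> hL; suff: 2 ^ K * \sum_(i < K.+1) L i + A <= 2 ^ K * (2 * A).
  by move=> h; rewrite -(leq_pmul2l (m := 2 ^ K)) ?expn_gt0 // (leq_trans (leq_addr _ _) h).
elim: K hL => [|K IH] hL.
  rewrite big_ord1 !mul1n mul2n -addnn leq_add2r.
  by have := hL 0 (leqnn 0); rewrite mul1n.
rewrite big_ord_recr /= mulnDr.
have /IH : forall i, i <= K -> 2 ^ i * L i <= A by move=> i iK; apply: hL; apply: leqW.
have := hL K.+1 (leqnn _); rewrite !expnS -!mulnA.
move: (2 ^ K) (L K.+1) (\sum_(i < K.+1) L i) => x y z; nia.
Qed.

(** Absorbs the overhead linear in [n] that is paid on each of at most [n.+1] levels. *)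
Lemma sqr_le_fact n : 1 < n -> n.+1 ^ 2 <= 6 * n`!.
Proof.
case: n => [|[|n]] // _; elim: n => // n IH; rewrite factS.
by rewrite mulnCA; apply: leq_trans (leq_mul (leqnn _) IH); rewrite -!mulnn; nia.
Qed.

Lemma fact_lt_exp n : 1 < n -> n.+1`! < n.+1 ^ n.
Proof.
case: n => [|[|n]] // _; elim: n => // n IH.
rewrite factS expnS ltn_pmul2l //; apply: leq_trans IH _.
by rewrite leq_exp2r.
Qed.

Lemma pk_nseq0 B i : pk B (nseq i 0) = 0.
Proof. by elim: i => //= i ->. Qed.

(** * The complete run for [n] at least 2 *)

Section Program.

Variables (w n k : nat) (P : seq nat).
Hypothesis PE : perm_eq P (iota 1 k).
Hypothesis w_gt0 : 0 < w.
Hypothesis n_gt1 : 1 < n.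
Hypothesis nw : n * letter_bits n <= w.
Hypothesis kW : k < 2 ^ w.

Let modn_bool b := modn_bool_word b w_gt0.

Let B := 2 ^ letter_bits n.
(** The top level. For [k > n] only level 0 is run, where every count is zero. *)
Let K := if k <= n then k else 0.

Lemma letter_bits_gt1 : 1 < letter_bits n.
Proof. by rewrite /letter_bits ltnS trunc_log_gt0. Qed.

Lemma n_lt_base : n < B.
Proof. exact: trunc_log_ltn. Qed.

Lemma base_exp_le : B ^ n <= 2 ^ w.
Proof. by rewrite -expnM mulnC leq_exp2l. Qed.

(** [n + 2 * n! <= (n + 1)! < (n + 1) ^ n <= B ^ n <= 2 ^ w], so all queue addresses fit in a
    word. *)
Lemma addresses_lt : n + 2 * n`! < 2 ^ w.
Proof.
apply: leq_trans base_exp_le; apply: (@leq_trans (n.+1 ^ n)); last first.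
  by rewrite leq_exp2r ?n_lt_base //; lia.
apply: leq_ltn_trans (fact_lt_exp n_gt1); rewrite factS [n.+1 * _]mulSn.
by apply: leq_add; [exact: fact_geq|rewrite leq_mul2r n_gt1 orbT].
Qed.

Lemma K_le_n : K <= n. Proof. by rewrite /K; case: ifP. Qed.
Lemma K_le_k : K <= k. Proof. by rewrite /K; case: ifP. Qed.

Lemma n2_lt : n.+2 < 2 ^ w.
Proof. by apply: leq_ltn_trans addresses_lt; have := fact_gt0 n; lia. Qed.

Lemma level_addresses_lt i : i <= n -> n + level_size i n < 2 ^ w.
Proof.
move=> ik; apply: leq_ltn_trans addresses_lt; rewrite leq_add2l.
by apply: leq_trans (level_size_fact ik); rewrite leq_pmull // fact_gt0.
Qed.

(** There are at most [2 ^ n] matches, and [n < n * letter_bits n <= w]. *)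
Lemma matches_lt i x : size x <= n -> matches k P i x < 2 ^ w.
Proof.
move=> xn; apply: leq_ltn_trans (matches_le_exp _ _ _ _) _; rewrite ltn_exp2l //.
apply: leq_ltn_trans xn _; apply: leq_trans nw.
by rewrite -[X in X < _]muln1 ltn_pmul2l ?letter_bits_gt1 //; lia.
Qed.

(** The value computed by the scan, which stops after [K] letters; it equals [rank_above k P i] when
    [K = k]. *)
Definition rank i := count (fun x => k - i < x) (take (minn K (index (k - i) P)) P).

(** The top [d] levels are tabulated. Tables above [K] are empty, so looking up there yields the
    default 0. *)
Definition solved d (tt : nat -> nat -> option nat) :=
  (forall j m x, K < j + d -> j <= K -> j + m <= n -> valid j m x ->
     tt j (pk B x) = Some (matches k P j x)) /\
  (forall j key, K < j -> tt j key = None).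

Lemma matches_ins_solved i d m y l tt : i + d = K -> solved d tt -> valid i m y ->
  i + m < n -> l <= i + m ->
  matches k P i (ins l m.+1 y) = matches k P i y +
    (zeros (take l y) == rank i) * odflt 0 (tt i.+1 (pk B (ins l 0 y))).
Proof.
move=> idK [s1 s2] yv imn li.
have szi : size (ins l m.+1 y) = i + m.+1 by apply: size_valid (ins_valid l yv).
case: (leqP k n) => kn; have EK := erefl K; rewrite {2}/K in EK; last first.
  (* Case [k > n]: only [i = 0] occurs, table 1 is empty, and all words are shorter than the
     pattern. *)
  have i0 : i = 0 by move: EK; rewrite leqNgt kn /=; lia.
  rewrite s2 ?muln0 ?addn0; last by move: EK; rewrite leqNgt kn /=; lia.
  by rewrite !matches_short // ?szi ?(size_valid yv) //; lia.
rewrite kn in EK; case: (ltnP i k) => ik; last first.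
  (* Case [i = k = K]: table [i.+1] is empty, and a fully marked pattern ignores positive
     letters. *)
  rewrite s2 ?muln0 ?addn0; last by lia.
  exact: matches_ins_full.
have -> : rank i = rank_above k P i.
  rewrite /rank /rank_above; congr (count _ (take _ _)).
  by apply/minn_idPr; rewrite EK -[X in _ <= X](size_word PE) index_size.
rewrite (s1 _ m) ?(ins0_valid l yv) //=; try lia.
apply: matches_ins => //; last exact: zeros_valid yv.
by rewrite /= (valid_lt yv).
Qed.

Lemma matches_nseq_solved i : i <= K -> matches k P i (nseq i 0) = (i == k).
Proof.
move=> iK; case: (leqP k n) => kn; have EK := erefl K; rewrite {2}/K in EK.
  by rewrite kn in EK; apply: matches_nseq => //; rewrite -EK.
have i0 : i = 0 by move: EK; rewrite leqNgt kn /=; lia.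
by rewrite i0 matches_short //=; [case: eqP => //; lia|lia].
Qed.

Section Scan.

Variables (i go r9 : nat) (rest : seq nat) (mm : nat -> nat) (tt : nat -> nat -> option nat).
Hypothesis mmP : forall j, j < K -> mm j = nth 0 P j.

Definition scan_inv j (g : cfg) := exists v : nat,
  g = Cfg ([:: n; k; 1; 0; n.+1; B; K; i; go; r9;
      count (fun x => k - i < x) (take (minn j (index (k - i) P)) P); k - i; j; v;
      nat_of_bool (j <= index (k - i) P); nat_of_bool (j < K)] ++ rest) mm tt.

Lemma scan_step j g : j < K -> scan_inv j g ->
  nth 0 (er g) 15 != 0 /\ Run w scan_body g 9 (scan_inv j.+1).
Proof.
move=> jK [v ->]; split; first by rewrite /= jK.
apply: (@run_block _ _ _ _ 0) => //.
rewrite /= /upd /nbin /= mmP // !modn_bool.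
set t := k - i; set v' := nth 0 P j; set x := index t P.
have jP : j < size P by rewrite (size_word PE); apply: leq_trans jK K_le_k.
have e1 : (j <= x) * (nat_of_bool (v' == t) == 0) = (j < x).
  rewrite mulnb; congr nat_of_bool; case: (v' =P t) => /= E.
    by rewrite andbF; apply/esym/negP => /(before_find 0); rewrite /= -/v' E eqxx.
  rewrite andbT leq_eqVlt; case: eqP => //= jx.
  by case: E; rewrite /v' jx nth_index // -index_mem -/x -jx.
have e2 : count (leq t.+1) (take (minn j x) P) + ((t < v') && (j < x)) =
    count (leq t.+1) (take (minn j.+1 x) P).
  case: (boolP (j < x)) => jx; last first.
    rewrite -leqNgt in jx.
    by rewrite (minn_idPr jx) (minn_idPr (leqW jx)) andbF addn0.
  rewrite (minn_idPl jx) (minn_idPl (ltnW jx)).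
  by rewrite (take_nth 0 jP) -cats1 count_cat /= andbT addn0.
rewrite e1 modn_bool mulnb modn_bool e2 [(j + 1) %% _]modn_small addn1; last first.
  by apply: leq_ltn_trans n2_lt; apply: leq_trans jK (leq_trans K_le_n _); lia.
rewrite [count _ _ %% _]modn_small; last first.
  apply: leq_ltn_trans n2_lt; apply: leq_trans (count_size _ _) _.
  have jn : j < n.+2 by apply: leq_trans jK (leq_trans K_le_n _); lia.
  by rewrite size_take_min !geq_min jn.
by apply: run_skip; eexists.
Qed.

Lemma scan_loop g : scan_inv 0 g ->
  Run w (While 15 scan_body) g (10 * K).+1 (scan_inv K).
Proof.
move=> I0; have := run_while I0 (C := fun=> 9) scan_step.
rewrite sum_nat_const card_ord mulnC; apply=> g'.
by case=> v ->; rewrite /= ltnn.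
Qed.

End Scan.

Lemma mem_upto i m d x : m <= d -> x \in gen i m -> x \in upto i d ++ gen i d.
Proof.
elim: d => [|d IH]; first by rewrite leqn0 => /eqP ->.
rewrite leq_eqVlt mem_cat => /predU1P[-> -> | md xg]; first by rewrite orbT.
by rewrite IH.
Qed.

Lemma solved_level i d mm tt m0 tt' : i + d = K -> solved d tt ->
  queue n B i (matches k P i) m0 tt (upto i (n - i) ++ gen i (n - i)) mm tt' ->
  solved d.+1 tt'.
Proof.
move=> idK [s1 s2] [_ _ q3 _ q5]; split=> [j m x|j key] Kj; last first.
  by rewrite q5 ?s2 // neq_ltn orbC; apply/orP; left; lia.
move=> jK jmn xv; case: (j =P i) => [ji|/eqP ji]; last first.
  by rewrite q5 // (s1 _ m) //; lia.
by rewrite ji in xv jmn *; apply: q3; apply: (@mem_upto _ m); [lia|apply: valid_gen].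
Qed.

(** Truncated subtraction covers the exit [d = K.+1]: the level register stays at 0 after level
    0. *)
Definition level_inv d (g : cfg) := exists rest mm tt,
  [/\ size rest = 22,
      g = Cfg ([:: n; k; 1; 0; n.+1; B; K; K - d; nat_of_bool (d <= K)] ++ rest) mm tt,
      forall j, j < K -> mm j = nth 0 P j & solved d tt].

Lemma level_step d g : d < K.+1 -> level_inv d g ->
  nth 0 (er g) 8 != 0 /\
  Run w level_body g (10 * n + 50 * level_size (K - d) n + 22) (level_inv d.+1).
Proof.
move=> dK [rest [mm [tt [szr -> mmP sol]]]]; split; first by rewrite /= -ltnS dK.
set i := K - d; have idK : i + d = K by rewrite subnK.
have iK : i <= K by apply: leq_subr.
have ik := leq_trans iK K_le_k; have i_le_n := leq_trans iK K_le_n.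
(* Names the leftover contents of registers 9 to 30, so that the register list is concrete and
   computes. *)
do 22!case: rest szr => [//|? rest] szr.
case: rest szr => // _.
have h1 : 1 %% 2 ^ w = 1 := modn_bool true.
apply: (@run_weaken _ _ _ (5 + ((10 * K).+1 + (11 + ((50 * level_size i n).+1 +
  (1 + 2))))) _ (level_inv d.+1)) => //; last by have := K_le_n; lia.
apply: run_block => //.
rewrite [foldl _ _ _]/= /upd (nbin_sub ik kW) /nbin /= h1 mod0n modn_bool.
apply: run_seq.
  apply: (@scan_loop i (d <= K) _ [:: _; _; _; _; _; _; _; _; _; _; _; _; _; _; _] mm tt mmP).
  by eexists; rewrite min0n take0.
move=> {}g [v ->]; apply: run_block => //.
rewrite [foldl _ _ _]/= /upd /nbin /= h1 mod0n !modn_bool -/(rank i).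
rewrite modn_small ?addn1; last by apply: leq_ltn_trans n2_lt; lia.
apply: run_seq.
  apply: (@lengths_loop w n k B K i (rank i) (d <= K) (matches k P i) mm tt) => //.
  - exact: n_lt_base.
  - exact: base_exp_le.
  - exact: n2_lt.
  - by move=> x; apply: matches_lt.
  - by move=> m y l; apply: matches_ins_solved sol.
  - exact: level_addresses_lt.
  do 16!eexists; split.
    by rewrite /= !addn0 addn1.
  (* The level starts from the empty queue, to which the word of [i] zeros is added as seed. *)
  have q0 : queue n B i (matches k P i) mm tt [::] mm tt by split.
  have vi : valid i 0 (nseq i 0) by rewrite /valid cats0.
  have := queue_rcons n_lt_base q0 _ vi.
  by rewrite pk_nseq0 matches_nseq_solved // [size _]/= !addn0; apply.
move=> {}g [? [? [? [? [? [? [? [? [? [? [? [? [? [? [mm' [tt' [-> q]]]]]]]]]]]]]]]]].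
apply: run_block => //.
rewrite [foldl _ _ _]/= /upd /nbin /= modn_bool.
apply: (@run_if _ _ _ _ _ 1); rewrite /=.
have sol' := solved_level idK sol q.
have mmP' j : j < K -> mm' j = nth 0 P j.
  by move=> jK; case: q => -> // *; [exact: mmP|exact: leq_trans jK K_le_n].
case: (posnP i) => i0 /=.
  apply: run_skip; eexists; exists mm', tt'; split; last exact: sol'; last exact: mmP'.
    2: by have [-> ->] : K - d.+1 = i /\ (d < K) = false by lia.
  by [].
apply: (@run_block _ _ _ _ 0) => //.
rewrite [foldl _ _ _]/= /upd nbin_sub //=; last exact: leq_ltn_trans ik kW.
apply: run_skip; eexists; exists mm', tt'; split; last exact: sol'; last exact: mmP'.
  2: by have [-> ->] : K - d.+1 = i - 1 /\ (d < K) = true by lia.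
by [].
Qed.

(** The level sizes add up to at most [8 * n!], and the remaining work is [O((n + 1) ^ 2)]. *)
Lemma level_loop g : level_inv 0 g ->
  Run w (While 8 level_body) g (2200 * n`!) (level_inv K.+1).
Proof.
move=> I0; apply: (run_weaken (run_while I0 level_step _)) => // [g'|].
  by case=> rest [mm [tt [_ -> _ _]]]; rewrite /= ltnn.
have -> : \sum_(j < K.+1) (10 * n + 50 * level_size (K - j) n + 22).+1 =
    \sum_(j < K.+1) (10 * n + 23) + 50 * \sum_(j < K.+1) level_size j n.
  rewrite [\sum_(j < K.+1) level_size j n](reindex_inj rev_ord_inj) big_distrr -big_split.
  by apply: eq_bigr => j _; rewrite /= subSS; lia.
have hs : \sum_(j < K.+1) level_size j n <= 2 * (4 * n`!).
  apply: (sum_geometric_le (L := level_size^~ n)) => i iK; apply: level_size_le.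
  exact: leq_trans iK K_le_n.
rewrite sum_nat_const card_ord.
have := sqr_le_fact n_gt1; have := fact_gt0 n; have := K_le_n; move: hs.
by move: (\sum_(j < K.+1) level_size j n) (n`!) => S f; rewrite -mulnn; nia.
Qed.

Definition base_inv j (g : cfg) :=
  g = Cfg ([:: n; k; 1; 0; n.+1; 2 ^ j; 0; 0; 0; 0; 0; 0; 0; 0; 0;
     nat_of_bool (2 ^ j < n.+1)] ++ nseq 15 0) (nth 0 P) (fun _ _ => None).

Lemma base_step j g : j < letter_bits n -> base_inv j g ->
  nth 0 (er g) 15 != 0 /\ Run w base_body g 2 (base_inv j.+1).
Proof.
move=> jL ->; split.
  have -> // : 2 ^ j < n.+1.
  rewrite ltnS; apply: leq_trans (trunc_logP (ltnSn 1) (ltnW n_gt1)).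
  by rewrite leq_exp2l.
apply: (@run_block _ _ _ _ 0) => //.
rewrite [foldl _ _ _]/= /upd /nbin /= modn_bool addnn -mul2n -expnS modn_small //.
  exact: run_skip.
rewrite ltn_exp2l //; apply: leq_trans nw; apply: leq_ltn_trans jL _.
have := letter_bits_gt1; nia.
Qed.

Lemma prog_correct : Run w prog
  (Cfg ([:: n; k] ++ nseq 29 0) (nth 0 P) (fun _ _ => None)) (2300 * n`!)
  (fun g => solved K.+1 (et g)).
Proof.
have h1 : 1 %% 2 ^ w = 1 := modn_bool true.
have Ln : letter_bits n <= n.
  exact: leq_trans (ltn_expl _ (ltnSn 1)) (trunc_logP (ltnSn 1) (ltnW n_gt1)).
apply: (@run_weaken _ _ _ (2 + (3 + ((3 * letter_bits n).+1 + (1 + (2 + (2 + 2200 * n`!))))).+1)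
  _ (fun g => solved K.+1 (et g))) => //; last first.
  by have := fact_geq n; lia.
apply: run_block => //; rewrite [foldl _ _ _]/= /upd /nbin /= h1 modn_bool.
apply: run_if; rewrite /= n_gt1 /=.
apply: run_block => //; rewrite [foldl _ _ _]/= /upd /nbin /= h1 modn_bool.
rewrite modn_small ?addn1; last by apply: leq_ltn_trans n2_lt; lia.
apply: run_seq.
  have := @run_while w 15 base_body base_inv (fun=> 2) (letter_bits n) _ _ base_step.
  rewrite sum_nat_const card_ord mulnC; apply; first by [].
  by move=> g ->; rewrite /= ltnS leqNgt n_lt_base.
move=> g ->; apply: run_block => //; rewrite [foldl _ _ _]/= /upd /nbin /= modn_bool ltnS.
apply: (@run_seq _ _ _ _ _ _ (fun g => exists t, g =
  Cfg ([:: n; k; 1; 0; n.+1; B; K; 0; 0; 0; 0; 0; 0; 0; 0; t] ++ nseq 15 0)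
    (nth 0 P) (fun _ _ => None))).
  apply: (@run_if _ _ _ _ _ 1); rewrite /= /K; case: (k <= n) => /=.
    apply: (@run_block _ _ _ _ 0) => //; apply: run_skip; eexists; reflexivity.
  by apply: run_skip; eexists; reflexivity.
move=> {}g [t ->]; apply: run_block => //.
rewrite [foldl _ _ _]/= /upd /= h1.
apply: (run_weaken (level_loop _)) => // [|g'].
  exists ([:: 0; 0; 0; 0; 0; 0; t] ++ nseq 15 0), (nth 0 P), (fun _ _ => None).
  split; first by [].
  - by rewrite subn0.
  - by [].
  by split=> // j m x; rewrite addn0; lia.
by case=> rest [mm [tt [_ -> _]]].
Qed.

End Program.

(** * Distinct output keys, the initial state, small [n], and the two time bounds *)

Lemma perm_word_pos n (t : 'S_n) : zeros (perm_word t) = 0.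
Proof. exact: (@zeros_valid 0 n _ (perm_word_iota t)). Qed.

Lemma perm_word_lt n (t : 'S_n) : all (fun a => a < 2 ^ letter_bits n) (perm_word t).
Proof. exact: valid_lt (perm_word_iota t : valid 0 n _) (trunc_log_ltn _ _). Qed.

Lemma pack_perm_inj n : injective (@pack_perm n).
Proof.
move=> t t'; rewrite /pack_perm !pack_pk => /Nnat.Nat2N.inj E.
have {E} : perm_word t = perm_word t'.
  by apply: pk_inj E; rewrite ?perm_word_lt ?perm_word_pos.
move=> /eq_in_map E; apply/permP => i; apply/val_inj.
by have [] := E i (mem_enum _ i).
Qed.

Lemma sim_init n k (p : 'S_k) : sim (init_state n p)
  (Cfg ([:: n; k] ++ nseq 29 0) (nth 0 (perm_word p)) (fun _ _ => None)).
Proof.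
split=> [[|[|r]]|a|//] //.
  by rewrite -[nth _ _ _]/(nth 0 (nseq 29 0) r) nth_nseq if_same.
rewrite /= Nnat.Nat2N.id; case: (ltnP a (size (perm_word p))) => ha.
  by rewrite (nth_map 0).
by rewrite [LHS]nth_default ?(size_map N.of_nat) // nth_default.
Qed.

Lemma card_hits_small n k (p : 'S_k) (t : 'S_n) : n <= 1 -> #|hits p t| = (k <= n).
Proof.
rewrite card_hits => n1; case: (leqP k n) => kn; last first.
  by rewrite matches_short ?perm_word_iota // (size_word (perm_word_iota t)).
have small m (s : 'S_m) : m <= 1 -> perm_word s = iota 1 m.
  by case: m s => [|[|//]] s _; apply: perm_small_eq (perm_word_iota s).
rewrite !small //; last exact: leq_trans n1.
by case: n kn n1 {t} => [|[|//]]; case: k {p} => [|[|//]].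
Qed.

Lemma prog_small w n k P : 0 < w -> n <= 1 -> Run w prog
  (Cfg ([:: n; k] ++ nseq 29 0) (nth 0 P) (fun _ _ => None)) 2300
  (fun g => et g 0 n = Some (nat_of_bool (k <= n))).
Proof.
move=> w0 n1; have mb b := modn_bool_word b w0.
apply: (@run_weaken _ _ _ (2 + (3 + 0).+1) _
  (fun g => et g 0 n = Some (nat_of_bool (k <= n)))) => //.
apply: run_block => //; rewrite [foldl _ _ _]/= /upd /nbin /= (mb true) mb.
apply: run_if; rewrite /= ltnNge n1 /=.
apply: run_block => //; rewrite [foldl _ _ _]/= /upd /nbin /= !mb.
by apply: run_skip; rewrite /= eqxx /= ltnNge; case: (k <= n).
Qed.

Lemma prog_hits w n k (p : 'S_k) : 0 < w -> n * letter_bits n <= w -> k < 2 ^ w ->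
  Run w prog
    (Cfg ([:: n; k] ++ nseq 29 0) (nth 0 (perm_word p)) (fun _ _ => None)) (2300 * n`!)
    (fun g => forall t : 'S_n,
       et g 0 (pk (2 ^ letter_bits n) (perm_word t)) = Some #|hits p t|).
Proof.
move=> w0 nw kW; case: (leqP n 1) => n1.
  have R := @prog_small w n k (perm_word p) w0 n1.
  apply: (run_weaken R) => {R} [|g gE t].
    by rewrite leq_pmulr // fact_gt0.
  rewrite card_hits_small // -gE; congr (et g 0 _).
  have -> : perm_word t = iota 1 n.
    by case: n n1 t {nw gE} => [|[|//]] _ t; apply: perm_small_eq (perm_word_iota t).
  by case: n n1 {t nw gE} => [|[|//]].
apply: (run_weaken (prog_correct (perm_word_iota p) w0 n1 nw kW)) => // g [s1 _] t.
rewrite card_hits; apply: (s1 _ n) => //; exact: perm_word_iota.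
Qed.

Theorem theorem5p5 :
  exists prog : cmd,
  forall cost : opcode -> nat, (forall o : opcode, 0 < cost o) ->
  exists c1 c2 : nat,
    [/\ 0 < c1, 0 < c2 &
      forall (k : nat) (p : 'S_k) (n w : nat),
        0 < w -> n * letter_bits n <= w -> k < 2 ^ w ->
        exists (T : nat) (s : state),
          [/\ exec w cost prog (init_state n p) T s,
              c1 * n`! <= T <= c2 * n`! &
              outputs_hits n p s]].
Proof.
exists prog => cost hc; set M := sumn (map cost opcodes).
have hM o : 0 < cost o <= M by rewrite hc cost_le_sum.
(* Both constants depend on the costs alone: 2300 bounds the unit-cost run per [n!], and [M] bounds
   the cost of every opcode. *)
exists 1, (M * 2300); split=> //.
  by rewrite muln_gt0 andbT; case/andP: (hM KConst) => h1; apply: leq_trans.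
move=> k p n w w0 nw kW.
have [T [s [e hT [g [_ _ ht] hg]]]] := prog_hits w0 nw kW (sim_init n p).
have out : outputs_hits n p s.
  by move=> t; rewrite /pack_perm pack_pk (ht 0) hg.
(* All [n!] distinct keys are in table 0 at the end and none at the start. *)
have lb : n`! <= T.
  pose L := [seq pack_perm t | t : 'S_n].
  have uL : uniq L by rewrite map_inj_uniq ?enum_uniq //; apply: pack_perm_inj.
  have := @count_keys_le_time _ unit_cost _ _ _ _ N0 _ (fun=> isT) uL e.
  rewrite [X in _ <= X + _](count_pred0 L) add0n; apply: leq_trans.
  rewrite (eq_in_count (a2 := predT)) ?count_predT ?size_image ?card_Sn //.
  by move=> key /mapP[t _ ->]; rewrite out.
have [T' e' /andP[h1 h2]] := exec_unit_cost hM e.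
exists T', s; split=> //; rewrite mul1n (leq_trans lb h1) (leq_trans h2) //.
by rewrite -mulnA leq_mul2l hT orbT.
Qed.
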